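(* For every $\epsilon>0$ there is $R$ such that for every $r>R$ the following hold for the curve $\Upsilon_r:[r,\infty)\to\mathbb{R}^2$, $\Upsilon_r(L)=\big(\tfrac12a_L(r),\tfrac12b_L(r)\big)$: $\Upsilon_r$ has exactly one cusp $L_r$; at every $L\ne L_r$ the velocity $d\Upsilon_r/dL$ has negative slope; and the cusp point $\Upsilon_r(L_r)=(a_r,b_r)$ satisfies $a_r<2+\epsilon$ and $b_r<(e^2/2+\epsilon)e^{r/2}$.
   Context: For $\alpha\in(0,1/\sqrt2)$ let $L_\alpha=\pi/\mathrm{AGM}(\alpha,\tfrac12\sqrt{1+2\alpha^2})$; $\alpha\mapsto L_\alpha$ is a decreasing bijection from $(0,1/\sqrt2)$ onto $(\pi\sqrt2,\infty)$. For $L>\pi\sqrt2$ let $\alpha$ satisfy $L_\alpha=L$ and let $x_0>y_0>0$ satisfy $x_0^2+y_0^2=1$, $x_0y_0=\alpha^2$. Let $(x_L,y_L,z_L)(t)$ solve $x'=-xz$, $y'=yz$, $z'=x^2-y^2$ with initial value $(x_0,y_0,0)$, and let $a_L,b_L$ solve $a'=2x_L+az_L$, $b'=2y_L-bz_L$ with $a_L(0)=b_L(0)=0$ ($'=d/dt$). A cusp of $\Upsilon_r$ is a parameter $L$ at which $d\Upsilon_r/dL=0$. *)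

(* Defs.v *)
From Stdlib Require Import Reals.
From Coquelicot Require Import Coquelicot.
Open Scope R_scope.

Fixpoint agm_iter (a b : R) (n : nat) : R * R :=
  match n with
  | O => (a, b)
  | S n' => let p := agm_iter a b n' in ((fst p + snd p) / 2, sqrt (fst p * snd p))
  end.

Definition AGM (a b : R) : R := real (Lim_seq (fun n => fst (agm_iter a b n))).

Definition Lalpha (alpha : R) : R :=
  PI / AGM alpha (sqrt (1 + 2 * alpha ^ 2) / 2).

Definition is_system_solution (L : R) (x y z a b : R -> R) : Prop :=
  exists alpha x0 y0 : R,
    0 < alpha < 1 / sqrt 2 /\ Lalpha alpha = L /\
    x0 > y0 /\ y0 > 0 /\ x0 ^ 2 + y0 ^ 2 = 1 /\ x0 * y0 = alpha ^ 2 /\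
    x 0 = x0 /\ y 0 = y0 /\ z 0 = 0 /\ a 0 = 0 /\ b 0 = 0 /\
    (forall t : R,
       is_derive x t (- (x t * z t)) /\
       is_derive y t (y t * z t) /\
       is_derive z t (x t ^ 2 - y t ^ 2) /\
       is_derive a t (2 * x t + a t * z t) /\
       is_derive b t (2 * y t - b t * z t)).

Definition Ups1 (A : R -> R -> R) (r L : R) : R := A L r / 2.
Definition Ups2 (B : R -> R -> R) (r L : R) : R := B L r / 2.

(* Main.v *)
Require Import Defs.
From Stdlib Require Import Reals Ranalysis5 Lra.
From Coquelicot Require Import Coquelicot.
Open Scope R_scope.

(** Write [al] for the parameter, [D = x^2 - y^2 = z'], [n = 4 al^4 / (1 - 4 al^4)] and let [E] be the primitive of
    [1 - z^2] vanishing at 0; then [a = (E + z) / x] and [b = (E - z) / y]. The variational equation in [ln al] at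
    fixed time [t] has the closed form solution [v = (1 + n) (z E + D) - n t z], and it gives
    [da/d(ln al) = F / x], [db/d(ln al) = - F / y] with [F = v' + v E - z]. So the slope is negative unless [F = 0],
    in which case the point is a cusp. By Gauss's AGM formula [L] is the period of the flow. As [al -> 0],
    [F = 8 + 16 z + o(1)] on the last quarter period and [dF/d(ln al) = 64 (1 - z^2) + o(1)] near its end, while
    [F < 0] on the first three quarters; hence [F] vanishes for exactly one [L >= r], and [r <= L_r <= r + 9/10].
    Since [a] decreases along [[r, L_r]], it is at most its value near 4 at [L = r]; and
    [b <= 4 al^-2 (1 + o(1)) <= 4 e^{L/2} (1 + o(1))]. *)

(** * Gauss's formula for the arithmetic-geometric mean *)

(** The closed form of [v] comes from symmetry. Scaling the flow gives the particular solution [t z]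
    of the variational equation [v'' = 2 D - 2 v (1 - z^2)], time translation gives the homogeneous
    solution [z], and reduction of order gives a second one, [z (E - t) + D]. Unit speed forces
    [v = 1 / D] at time 0, which fixes the coefficient of the latter as [1 + n = 1 / D(0)^2]. The
    solutions form an unstructured family, one for each [L], so differentiability in [al] has to be
    proved; as the derivative is known explicitly, a Gronwall estimate of the remainder suffices.
    The limit [al -> 0] cannot decide the sign of [F] early on, because [F] vanishes at [t = 0]; the
    first half period rests on the exact identity [z F = v (z E + D) - 1] instead. When a time [u]
    is left, [z] tends to [- tanh u], so the cusp appears near [tanh u = 1/2], that is
    [u = 0.549...]. The cutoff 9/10 leaves room on every side: [8 - 16 tanh u] is well below 0
    there, [1 - tanh^2 u] is bounded away from 0 before it, and [2 e^{9/20} < e^2 / 2]. *)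

(* Coquelicot states some equalities of reals at a module type that [field] does not recognize *)
Ltac eq_R := match goal with |- ?x = ?y => change (@eq R x y) end.

Lemma RInt_Rmult_l (f : R -> R) (a b k : R) : ex_RInt f a b ->
  RInt (fun x => k * f x) a b = k * RInt f a b.
Proof. exact (RInt_scal (V := R_CompleteNormedModule) f a b k). Qed.

Lemma ex_derive_continuity_pt (f : R -> R) (x : R) : ex_derive f x -> continuity_pt f x.
Proof. intros H. apply continuity_pt_filterlim. exact (ex_derive_continuous (V := R_NormedModule) f x H). Qed.

Lemma RInt_Rconst (a b c : R) : RInt (fun _ => c) a b = (b - a) * c.
Proof. exact (RInt_const (V := R_CompleteNormedModule) a b c). Qed.

Lemma cos2_sin2 (u : R) : cos u ^ 2 + sin u ^ 2 = 1.
Proof. generalize (sin2_cos2 u). unfold Rsqr. lra. Qed.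

Definition ell_form (a b u : R) : R := a ^ 2 * cos u ^ 2 + b ^ 2 * sin u ^ 2.

Definition ell_int (a b : R) : R := RInt (fun u => / sqrt (ell_form a b u)) 0 (PI / 2).

Lemma ell_form_bounds (a b u : R) : 0 < a -> 0 < b ->
  Rmin a b ^ 2 <= ell_form a b u <= Rmax a b ^ 2.
Proof.
intros Ha Hb. unfold ell_form.
generalize (cos2_sin2 u) (pow2_ge_0 (cos u)) (pow2_ge_0 (sin u)).
set (C := cos u ^ 2). set (S := sin u ^ 2). intros H1 H2 H3.
replace S with (1 - C) by lra.
assert (HC : 0 <= C <= 1) by lra.
unfold Rmin, Rmax. destruct (Rle_dec a b).
- assert (0 <= b ^ 2 - a ^ 2) by nra. split; nra.
- assert (0 <= a ^ 2 - b ^ 2) by nra. split; nra.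
Qed.

Lemma ell_form_pos (a b u : R) : 0 < a -> 0 < b -> 0 < ell_form a b u.
Proof.
intros Ha Hb. apply Rlt_le_trans with (Rmin a b ^ 2).
- apply pow_lt. now apply Rmin_glb_lt.
- now apply ell_form_bounds.
Qed.

Lemma continuous_ell_integrand (a b u : R) : 0 < a -> 0 < b ->
  continuous (fun u => / sqrt (ell_form a b u)) u.
Proof.
intros Ha Hb. generalize (ell_form_pos a b u Ha Hb); intros H.
apply (ex_derive_continuous (V := R_NormedModule)). unfold ell_form in *. auto_derive.
split; [ lra | split; [ apply Rgt_not_eq; apply sqrt_lt_R0; lra | easy ] ].
Qed.

Lemma ex_RInt_ell (a b p q : R) : 0 < a -> 0 < b ->
  ex_RInt (fun u => / sqrt (ell_form a b u)) p q.
Proof. intros. apply (ex_RInt_continuous (V := R_CompleteNormedModule)). intros. now apply continuous_ell_integrand. Qed.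

(** Landen substitution: [phi' = (a + b) P / Q] while the root of the new form at [phi u] is
    [(a + b) P / (2 sqrt Q)], with [Q] the old form, so the integrand becomes [2 / sqrt Q]. As [u]
    runs over a quarter turn [phi] runs over a half turn, and the two factors 2 cancel. *)
Lemma ell_int_gauss (a b : R) : 0 < a -> 0 < b ->
  ell_int ((a + b) / 2) (sqrt (a * b)) = ell_int a b.
Proof.
intros Ha Hb.
assert (Ha1 : 0 < (a + b) / 2) by lra.
assert (Hab : 0 < a * b) by nra.
assert (Hb1 : 0 < sqrt (a * b)) by now apply sqrt_lt_R0.
set (f := fun u => / sqrt (ell_form ((a + b) / 2) (sqrt (a * b)) u)).
assert (Hf : forall p q, ex_RInt f p q) by (intros; now apply ex_RInt_ell).
set (P := fun u => a * cos u ^ 2 + b * sin u ^ 2).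
set (N := fun u => (b - a) * (sin u * cos u)).
assert (HP : forall u, 0 < P u).
{ intros u. unfold P. generalize (cos2_sin2 u) (pow2_ge_0 (cos u)) (pow2_ge_0 (sin u)). nra. }
(* [P + i N = (a cos u + i b sin u) (cos u - i sin u)]: its modulus squared is the form, and since
   [P > 0] its argument is [atan (N / P)] without jumps. *)
assert (HPN : forall u, P u ^ 2 + N u ^ 2 = ell_form a b u).
{ intros u. unfold P, N, ell_form. replace (a ^ 2 * cos u ^ 2 + b ^ 2 * sin u ^ 2) with ((a ^ 2 * cos u ^ 2 + b ^ 2 * sin u ^ 2) * (cos u ^ 2 + sin u ^ 2)) by (rewrite cos2_sin2; ring). ring. }
(* the amplitude of the ascending Landen transformation, [u + atan (b / a * tan u)], written without its poles *)
set (phi := fun u => 2 * u + atan (N u / P u)).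
assert (HQ : forall u, 0 < ell_form a b u) by (intros; now apply ell_form_pos).
assert (Hsq : forall u, sqrt (1 + (N u / P u)²) = sqrt (ell_form a b u) / P u).
{ intros u. rewrite <- (HPN u).
  replace (1 + (N u / P u)²) with ((P u ^ 2 + N u ^ 2) / P u ^ 2) by (unfold Rsqr; field; apply Rgt_not_eq, HP).
  rewrite sqrt_div_alt by (apply pow_lt, HP). rewrite sqrt_pow2 by (left; apply HP). reflexivity. }
assert (Hphi : forall u, ell_form ((a + b) / 2) (sqrt (a * b)) (phi u) = ((a + b) * P u / 2) ^ 2 / ell_form a b u).
{ intros u. unfold ell_form at 1. rewrite pow2_sqrt by lra.
  unfold phi. rewrite cos_plus, sin_plus, cos_atan, sin_atan, Hsq.
  rewrite cos_2a, sin_2a.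
  generalize (sqrt_lt_R0 _ (HQ u)) (pow2_sqrt _ (Rlt_le _ _ (HQ u))) (HP u).
  set (s := sqrt (ell_form a b u)). intros H1 H2 H3. rewrite <- H2.
  generalize (cos2_sin2 u) . unfold P at 3. unfold N, P in *. set (c := cos u) in *. set (d := sin u) in *. intros H4.
  transitivity (((a + b) / 2) ^ 2 * ((a * c ^ 2 - b * d ^ 2) * (c ^ 2 + d ^ 2) / s) ^ 2 + a * b * ((a + b) * (d * c) * (c ^ 2 + d ^ 2) / s) ^ 2).
  - field. split; lra.
  - rewrite H4. field. lra. }
assert (Hd : forall u, is_derive phi u ((a + b) * P u / ell_form a b u)).
{ intros u. generalize (HP u) (HPN u) (HQ u). intros H1 H2 H3. unfold phi, N, P in *. auto_derive.
  - lra.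
  - generalize (cos2_sin2 u). rewrite <- H2. set (c := cos u) in *. set (d := sin u) in *. intros H4.
    assert (H5 : 0 < (a * c ^ 2 + b * d ^ 2) ^ 2 + ((b - a) * (d * c)) ^ 2) by (rewrite H2; apply HQ).
    set (p := a * c ^ 2 + b * d ^ 2) in *.
    replace (a * (c * (c * 1)) + b * (d * (d * 1))) with p by (unfold p; ring).
    transitivity ((2 * (p ^ 2 + ((b - a) * (d * c)) ^ 2) + (b - a) * ((c ^ 2 - d ^ 2) * p - d * c * (2 * (b - a) * (d * c)))) / (p ^ 2 + ((b - a) * (d * c)) ^ 2)).
    + unfold p. field. fold p. split; apply Rgt_not_eq; [ exact H5 | exact H1 ].
    + f_equal.
      replace ((a + b) * p) with ((a + b) * p * (c ^ 2 + d ^ 2)) by (rewrite H4; ring).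
      replace (2 * (p ^ 2 + ((b - a) * (d * c)) ^ 2)) with (2 * p ^ 2 + 2 * ((b - a) * (d * c)) ^ 2) by ring.
      unfold p. ring. }
assert (E1 : RInt (fun u => scal ((a + b) * P u / ell_form a b u) (f (phi u))) 0 (PI / 2) = RInt f (phi 0) (phi (PI / 2))).
{ apply (RInt_comp (V := R_CompleteNormedModule) f phi).
  - intros. now apply continuous_ell_integrand.
  - intros u _. split; [ apply Hd | ].
    apply (ex_derive_continuous (V := R_NormedModule)). generalize (HQ u). unfold P, ell_form. intros H. auto_derive. lra. }
rewrite (RInt_ext _ (fun u => 2 * / sqrt (ell_form a b u))) in E1.
2:{ intros u _. unfold f. rewrite Hphi. rewrite sqrt_div_alt by apply HQ.
  generalize (HP u) (sqrt_lt_R0 _ (HQ u)). intros H1 H2.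
  rewrite sqrt_pow2 by nra.
  change (scal ?x ?y) with (x * y).
  rewrite <- (pow2_sqrt (ell_form a b u)) at 1 by (left; apply HQ).
  eq_R. field. repeat split; nra. }
rewrite RInt_Rmult_l in E1 by now apply ex_RInt_ell.
assert (H0 : phi 0 = 0).
{ unfold phi, N. rewrite sin_0. replace ((b - a) * (0 * cos 0) / P 0) with 0 by (field; apply Rgt_not_eq, HP). rewrite atan_0. ring. }
assert (H1 : phi (PI / 2) = PI).
{ unfold phi, N. rewrite cos_PI2. replace ((b - a) * (sin (PI / 2) * 0) / P (PI / 2)) with 0 by (field; apply Rgt_not_eq, HP). rewrite atan_0. field. }
rewrite H0, H1 in E1.
rewrite <- (RInt_Chasles f 0 (PI / 2) PI) in E1 by apply Hf.
assert (E2 : RInt f (PI / 2) PI = RInt f 0 (PI / 2)).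
{ assert (E3 := RInt_comp_lin f (-1) PI (PI / 2) 0).
  rewrite RInt_ext with (g := fun y => -1 * f y) in E3.
  - replace (-1 * (PI / 2) + PI) with (PI / 2) in E3 by field. replace (-1 * 0 + PI) with PI in E3 by ring.
    rewrite <- E3 by apply Hf. rewrite RInt_Rmult_l by apply Hf.
    rewrite <- (opp_RInt_swap f) by apply Hf. change (-1 * - RInt f 0 (PI / 2) = RInt f 0 (PI / 2)). ring.
  - intros u _. unfold f, ell_form. replace (-1 * u + PI) with (PI - u) by ring.
    rewrite sin_PI_x, Rtrigo_facts.cos_pi_minus.
    replace ((- cos u) ^ 2) with (cos u ^ 2) by ring. reflexivity. }
rewrite E2 in E1. change (2 * ell_int a b = RInt f 0 (PI / 2) + RInt f 0 (PI / 2)) in E1.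
change (RInt f 0 (PI / 2) = ell_int a b). lra.
Qed.

Lemma ell_int_bounds (a b : R) : 0 < a -> 0 < b ->
  PI / 2 / Rmax a b <= ell_int a b <= PI / 2 / Rmin a b.
Proof.
intros Ha Hb. assert (Hm : 0 < Rmin a b) by now apply Rmin_glb_lt.
assert (HM : 0 < Rmax a b) by (apply Rlt_le_trans with a; [ easy | apply Rmax_l ]).
assert (HPI := PI_RGT_0).
assert (Hs : forall u, Rmin a b <= sqrt (ell_form a b u) <= Rmax a b).
{ intros u. destruct (ell_form_bounds a b u Ha Hb) as [H1 H2]. split.
  - rewrite <- (sqrt_pow2 (Rmin a b)) by lra. now apply sqrt_le_1_alt.
  - rewrite <- (sqrt_pow2 (Rmax a b)) by lra. now apply sqrt_le_1_alt. }
unfold ell_int. split.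
- replace (PI / 2 / Rmax a b) with (RInt (fun _ => / Rmax a b) 0 (PI / 2)).
  + apply RInt_le; [ lra | apply ex_RInt_const | now apply ex_RInt_ell | ].
    intros u _. apply Rinv_le_contravar; [ apply Rlt_le_trans with (Rmin a b) | ]; now try apply Hs.
  + rewrite RInt_Rconst. eq_R. field. lra.
- replace (PI / 2 / Rmin a b) with (RInt (fun _ => / Rmin a b) 0 (PI / 2)).
  + apply RInt_le; [ lra | now apply ex_RInt_ell | apply ex_RInt_const | ].
    intros u _. apply Rinv_le_contravar; now try apply Hs.
  + rewrite RInt_Rconst. eq_R. field. lra.
Qed.

Lemma ell_int_pos (a b : R) : 0 < a -> 0 < b -> 0 < ell_int a b.
Proof.
intros Ha Hb. apply Rlt_le_trans with (2 := proj1 (ell_int_bounds a b Ha Hb)).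
assert (HPI := PI_RGT_0).
apply Rdiv_lt_0_compat; [ lra | apply Rlt_le_trans with a; [ easy | apply Rmax_l ] ].
Qed.

Lemma agm_step_dist (a b : R) : 0 < a -> 0 < b ->
  Rabs ((a + b) / 2 - sqrt (a * b)) <= Rabs (a - b) / 2.
Proof.
intros Ha Hb.
assert (H1 := sqrt_lt_R0 a Ha). assert (H2 := sqrt_lt_R0 b Hb).
assert (H3 := pow2_sqrt a (Rlt_le _ _ Ha)). assert (H4 := pow2_sqrt b (Rlt_le _ _ Hb)).
rewrite sqrt_mult by lra. set (s := sqrt a) in *. set (t := sqrt b) in *.
rewrite <- H3, <- H4.
replace ((s ^ 2 + t ^ 2) / 2 - s * t) with ((s - t) ^ 2 / 2) by field.
rewrite Rabs_pos_eq by (generalize (pow2_ge_0 (s - t)); lra).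
replace (s ^ 2 - t ^ 2) with ((s - t) * (s + t)) by ring.
rewrite Rabs_mult, (Rabs_pos_eq (s + t)) by lra.
unfold Rabs. destruct (Rcase_abs (s - t)); nra.
Qed.

Lemma agm_iter_spec (a b : R) (n : nat) : 0 < a -> 0 < b ->
  let p := agm_iter a b n in
  0 < fst p /\ 0 < snd p /\ ell_int (fst p) (snd p) = ell_int a b /\
  Rabs (fst p - snd p) <= Rabs (a - b) * (1 / 2) ^ n.
Proof.
intros Ha Hb. induction n as [|n IH]; simpl.
- repeat split; try lra.
- destruct IH as (H1 & H2 & H3 & H4). set (p := agm_iter a b n) in *. repeat split.
  + lra.
  + apply sqrt_lt_R0. now apply Rmult_lt_0_compat.
  + now rewrite ell_int_gauss.
  + apply Rle_trans with (1 := agm_step_dist _ _ H1 H2). lra.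
Qed.

(** The integral is constant along the iteration and at each stage lies between [PI / 2] over the
    larger and over the smaller mean. So the claimed limit stays between the two means, whose gap at
    least halves at each step. *)
Lemma AGM_ell_int (a b : R) : 0 < a -> 0 < b -> AGM a b = PI / (2 * ell_int a b).
Proof.
intros Ha Hb. assert (HJ := ell_int_pos a b Ha Hb). assert (HPI := PI_RGT_0).
unfold AGM. rewrite (is_lim_seq_unique _ (PI / (2 * ell_int a b))); [ easy | ].
set (M := PI / (2 * ell_int a b)).
assert (Hn : forall n, Rabs (fst (agm_iter a b n) - M) <= Rabs (a - b) * (1 / 2) ^ n).
{ intros n. destruct (agm_iter_spec a b n Ha Hb) as (H1 & H2 & H3 & H4).
  apply Rle_trans with (2 := H4). set (p := agm_iter a b n) in *.
  destruct (ell_int_bounds _ _ H1 H2) as [H5 H6]. rewrite H3 in H5, H6.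
  assert (Hm : 0 < Rmin (fst p) (snd p)) by now apply Rmin_glb_lt.
  assert (HM : 0 < Rmax (fst p) (snd p)) by (apply Rlt_le_trans with (fst p); [ easy | apply Rmax_l ]).
  assert (H7 : M <= Rmax (fst p) (snd p)).
  { unfold M. apply Rmult_le_reg_r with (2 * ell_int a b); [ lra | ].
    apply Rmult_le_compat_r with (r := 2 * Rmax (fst p) (snd p)) in H5; [ | lra ].
    field_simplify in H5; try lra. field_simplify; lra. }
  assert (H8 : Rmin (fst p) (snd p) <= M).
  { unfold M. apply Rmult_le_reg_r with (2 * ell_int a b); [ lra | ].
    apply Rmult_le_compat_r with (r := 2 * Rmin (fst p) (snd p)) in H6; [ | lra ].
    field_simplify in H6; try lra. field_simplify; lra. }
  revert H7 H8. unfold Rmax, Rmin. destruct (Rle_dec (fst p) (snd p)); unfold Rabs;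
  destruct (Rcase_abs (fst p - M)), (Rcase_abs (fst p - snd p)); lra. }
apply (is_lim_seq_le_le (fun n => M - Rabs (a - b) * (1 / 2) ^ n) _ (fun n => M + Rabs (a - b) * (1 / 2) ^ n)).
- intros n. generalize (Rabs_le_between (fst (agm_iter a b n) - M) (Rabs (a - b) * (1 / 2) ^ n)). intros [H _]. specialize (H (Hn n)). lra.
- replace (Finite M) with (Rbar_minus M (Rbar_mult (Rabs (a - b)) 0)) by (simpl; f_equal; ring).
  apply (is_lim_seq_minus _ _ M (Rabs (a - b) * 0)); [ apply is_lim_seq_const | | easy ].
  apply (is_lim_seq_scal_l _ _ 0). apply is_lim_seq_geom. rewrite Rabs_pos_eq; lra.
- replace (Finite M) with (Rbar_plus M (Rbar_mult (Rabs (a - b)) 0)) by (simpl; f_equal; ring).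
  apply (is_lim_seq_plus _ _ M (Rabs (a - b) * 0)); [ apply is_lim_seq_const | | easy ].
  apply (is_lim_seq_scal_l _ _ 0). apply is_lim_seq_geom. rewrite Rabs_pos_eq; lra.
Qed.

Lemma sqrt_1_2sq_pos (al : R) : 0 < sqrt (1 + 2 * al ^ 2) / 2.
Proof. assert (0 < sqrt (1 + 2 * al ^ 2)) by (apply sqrt_lt_R0; nra). lra. Qed.

Lemma Lalpha_ell_int (al : R) : 0 < al ->
  Lalpha al = 2 * ell_int al (sqrt (1 + 2 * al ^ 2) / 2).
Proof.
intros H. assert (H1 := sqrt_1_2sq_pos al). assert (HPI := PI_RGT_0).
unfold Lalpha. rewrite AGM_ell_int by easy. assert (H2 := ell_int_pos _ _ H H1). field. lra.
Qed.

(** * Size and monotonicity of the period *)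

Definition small_param (al : R) : Prop := 0 < al < 1 / sqrt 2.

Lemma small_param_sq (al : R) : small_param al <-> 0 < al /\ 2 * al ^ 2 < 1.
Proof.
unfold small_param. assert (H := sqrt_lt_R0 2 ltac:(lra)). assert (H2 := pow2_sqrt 2 ltac:(lra)).
split; intros [H3 H4]; split; try easy.
- apply Rmult_lt_compat_r with (r := sqrt 2) in H4; [ | easy ]. field_simplify in H4; [ | lra ]. nra.
- apply Rmult_lt_reg_r with (sqrt 2); [ easy | ]. field_simplify; [ | lra ].
  apply Rnot_le_lt. intros H5. nra.
Qed.

(** This is what makes [al] small when the period is large. *)
Lemma Lalpha_upper (al : R) : small_param al -> Lalpha al <= PI / al.
Proof.
intros H. apply small_param_sq in H. destruct H as [H1 H2].
assert (H3 := sqrt_1_2sq_pos al). rewrite Lalpha_ell_int by easy.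
destruct (ell_int_bounds _ _ H1 H3) as [_ H4].
assert (H5 : Rmin al (sqrt (1 + 2 * al ^ 2) / 2) = al).
{ apply Rmin_left. assert (H5 := pow2_sqrt (1 + 2 * al ^ 2) ltac:(nra)). nra. }
rewrite H5 in H4. apply Rmult_le_compat_l with (r := 2) in H4; [ | lra ].
replace (PI / al) with (2 * (PI / 2 / al)) by (field; lra). exact H4.
Qed.

Lemma Lalpha_lower (al : R) : small_param al -> PI * sqrt 2 < Lalpha al.
Proof.
intros H. assert (H0 := H). apply small_param_sq in H. destruct H as [H1 H2].
assert (HPI := PI_RGT_0). assert (H3 := sqrt_1_2sq_pos al). rewrite Lalpha_ell_int by easy.
destruct (ell_int_bounds _ _ H1 H3) as [H4 _].
assert (Hs := sqrt_lt_R0 2 ltac:(lra)). assert (Hs2 := pow2_sqrt 2 ltac:(lra)).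
set (M := Rmax al (sqrt (1 + 2 * al ^ 2) / 2)) in *.
assert (H6 : 0 < M) by (apply Rlt_le_trans with al; [ easy | apply Rmax_l ]).
assert (H5 : M < sqrt 2 / 2).
{ apply Rmax_lub_lt.
  - destruct H0 as [_ H0]. replace (sqrt 2 / 2) with (1 / sqrt 2); [ easy | ]. apply Rmult_eq_reg_r with (sqrt 2); [ | lra ]. field_simplify; lra.
  - assert (sqrt (1 + 2 * al ^ 2) < sqrt 2) by (apply sqrt_lt_1_alt; nra). lra. }
apply Rlt_le_trans with (2 * (PI / 2 / M)); [ | lra ].
apply Rmult_lt_reg_r with M; [ easy | ]. replace (2 * (PI / 2 / M) * M) with PI by (field; lra).
apply Rlt_le_trans with (PI * sqrt 2 * (sqrt 2 / 2)).
- apply Rmult_lt_compat_l; [ now apply Rmult_lt_0_compat | easy ].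
- replace (PI * sqrt 2 * (sqrt 2 / 2)) with (PI * (sqrt 2 ^ 2) / 2) by field. rewrite Hs2. lra.
Qed.

Lemma continuity_2d_pt_snd_comp (f : R -> R) (u v : R) :
  continuity_pt f v -> continuity_2d_pt (fun _ w => f w) u v.
Proof.
intros H. apply (continuity_1d_2d_pt_comp f (fun _ w => w)); [ easy | ].
apply continuity_2d_pt_id2.
Qed.

(** Once the second mean is expressed through [al], the form is a polynomial increasing in [al];
    differentiation under the integral sign then gives an everywhere negative integrand. *)
Lemma Lalpha_derive (al : R) : 0 < al -> exists l, l < 0 /\ is_derive Lalpha al l.
Proof.
intros Hal. assert (HPI := PI_RGT_0).
set (g := fun u t => u ^ 2 * ((1 + cos t ^ 2) / 2) + sin t ^ 2 / 4).
assert (Hg : forall u t, ell_form u (sqrt (1 + 2 * u ^ 2) / 2) t = g u t).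
{ intros u t. unfold ell_form, g.
  replace ((sqrt (1 + 2 * u ^ 2) / 2) ^ 2) with ((sqrt (1 + 2 * u ^ 2)) ^ 2 / 4) by field.
  rewrite pow2_sqrt by nra. generalize (cos2_sin2 t). intros H.
  replace (sin t ^ 2) with (1 - cos t ^ 2) by lra. field. }
assert (Hgp : forall u t, 0 < u -> 0 < g u t).
{ intros u t Hu. unfold g. generalize (pow2_ge_0 (cos t)) (pow2_ge_0 (sin t)). nra. }
set (dg := fun u t => - (u * ((1 + cos t ^ 2) / 2)) * / (g u t * sqrt (g u t))).
assert (Hd : forall u t, 0 < u -> is_derive (fun w => / sqrt (g w t)) u (dg u t)).
{ intros u t Hu. generalize (Hgp u t Hu). intros H. assert (H2 := sqrt_lt_R0 _ H).
  assert (H3 := pow2_sqrt _ (Rlt_le _ _ H)). unfold dg, g in *. simpl pow in *. auto_derive.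
  - split; [ lra | split; [ apply Rgt_not_eq; lra | easy ] ].
  - set (w := u * (u * 1) * _ + _) in *. set (s := sqrt w) in *. rewrite <- H3. field. lra. }
assert (Hcont : forall u t, 0 < u -> continuity_pt (dg u) t).
{ intros u t Hu. generalize (Hgp u t Hu). intros H. assert (H2 := sqrt_lt_R0 _ H).
  apply ex_derive_continuity_pt. unfold dg, g in *. simpl pow in *. auto_derive.
  split; [ lra | split; [ apply Rgt_not_eq; apply Rmult_lt_0_compat; lra | easy ] ]. }
assert (HI : is_derive (fun u => RInt (fun t => / sqrt (g u t)) 0 (PI / 2)) al (RInt (fun t => Derive (fun u => / sqrt (g u t)) al) 0 (PI / 2))).
{ assert (Hloc : locally al (fun u => 0 < u)).
  { apply (locally_interval _ al 0 p_infty); simpl; easy. }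
  apply (is_derive_RInt_param (fun u t => / sqrt (g u t))).
  - revert Hloc. apply filter_imp. intros u Hu t _. eexists. now apply Hd.
  - intros t _. apply continuity_2d_pt_ext_loc with dg.
    + destruct Hloc as [d Hloc]. exists d. intros u v Hu _. symmetry. apply is_derive_unique, Hd, Hloc, Hu.
    + assert (Hcos : forall x, continuity_pt (fun t => (1 + cos t ^ 2) / 2) x).
      { intros x. apply ex_derive_continuity_pt. auto_derive. easy. }
      assert (Hsin : forall x, continuity_pt (fun t => sin t ^ 2 / 4) x).
      { intros x. apply ex_derive_continuity_pt. auto_derive. easy. }
      assert (Hg2 : continuity_2d_pt g al t).
      { unfold g. apply continuity_2d_pt_plus; [ apply continuity_2d_pt_mult | ].
        - apply (continuity_1d_2d_pt_comp (fun w => w ^ 2) (fun u _ => u)); [ | apply continuity_2d_pt_id1 ].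
          apply ex_derive_continuity_pt. auto_derive. easy.
        - now apply (continuity_2d_pt_snd_comp (fun t => (1 + cos t ^ 2) / 2)).
        - now apply (continuity_2d_pt_snd_comp (fun t => sin t ^ 2 / 4)). }
      unfold dg. apply continuity_2d_pt_mult; [ apply continuity_2d_pt_opp, continuity_2d_pt_mult | ].
      * apply continuity_2d_pt_id1.
      * now apply (continuity_2d_pt_snd_comp (fun t => (1 + cos t ^ 2) / 2)).
      * apply continuity_2d_pt_inv.
        -- apply continuity_2d_pt_mult; [ easy | ]. apply continuity_1d_2d_pt_comp; [ | easy ].
           apply continuity_pt_sqrt. left. now apply Hgp.
        -- apply Rgt_not_eq, Rmult_lt_0_compat; [ now apply Hgp | now apply sqrt_lt_R0, Hgp ].
  - revert Hloc. apply filter_imp. intros u Hu. apply (ex_RInt_continuous (V := R_CompleteNormedModule)).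
    intros t _. apply (continuous_ext (fun t => / sqrt (ell_form u (sqrt (1 + 2 * u ^ 2) / 2) t))).
    + intros x. now rewrite Hg.
    + apply continuous_ell_integrand; [ easy | apply sqrt_1_2sq_pos ]. }
rewrite (RInt_ext _ (dg al)) in HI by (intros t _; now apply is_derive_unique, Hd).
exists (2 * RInt (dg al) 0 (PI / 2)). split.
- assert (H : RInt (dg al) 0 (PI / 2) < RInt (fun _ => 0) 0 (PI / 2)).
  { apply RInt_lt; [ lra | intros; apply continuous_const | intros; now apply continuity_pt_filterlim, Hcont | ].
    intros t _. unfold dg. rewrite <- Ropp_mult_distr_l. apply Ropp_lt_gt_0_contravar.
    apply Rmult_lt_0_compat.
    - generalize (pow2_ge_0 (cos t)). nra.
    - apply Rinv_0_lt_compat, Rmult_lt_0_compat; [ now apply Hgp | now apply sqrt_lt_R0, Hgp ]. }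
  rewrite RInt_Rconst in H. lra.
- apply (is_derive_ext_loc (fun u => 2 * RInt (fun t => / sqrt (g u t)) 0 (PI / 2))).
  + apply (locally_interval _ al 0 p_infty); simpl; [ easy | easy | ]. intros u Hu _.
    rewrite Lalpha_ell_int by easy. f_equal. apply RInt_ext. intros t _. now rewrite Hg.
  + now apply is_derive_scal.
Qed.

(** * The geodesic flow and its symmetries *)

Lemma deriv_ge0_incr (f df : R -> R) (a b : R) : a <= b ->
  (forall t, a <= t <= b -> is_derive f t (df t)) ->
  (forall t, a <= t <= b -> 0 <= df t) -> f a <= f b.
Proof.
intros Hab Hd Hp. destruct (MVT_gen f a b df) as (c & Hc & H).
- intros t. rewrite Rmin_left, Rmax_right by easy. intros Ht. apply Hd; lra.
- intros t. rewrite Rmin_left, Rmax_right by easy. intros Ht. apply ex_derive_continuity_pt.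
  exists (df t). now apply Hd.
- rewrite Rmin_left, Rmax_right in Hc by easy. specialize (Hp c Hc). nra.
Qed.

Lemma deriv_le0_decr (f df : R -> R) (a b : R) : a <= b ->
  (forall t, a <= t <= b -> is_derive f t (df t)) ->
  (forall t, a <= t <= b -> df t <= 0) -> f b <= f a.
Proof.
intros Hab Hd Hp. apply Ropp_le_cancel.
apply (deriv_ge0_incr (fun t => - f t) (fun t => - df t)); [ easy | | ].
- intros t Ht. apply (is_derive_opp (V := R_NormedModule)). now apply Hd.
- intros t Ht. specialize (Hp t Ht). lra.
Qed.

Lemma deriv_gt0_incr (f df : R -> R) (a b : R) : a < b ->
  (forall t, a <= t <= b -> is_derive f t (df t)) ->
  (forall t, a < t < b -> 0 < df t) -> f a < f b.
Proof.
intros Hab Hd Hp.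
destruct (MVT_cor2 f df a b Hab) as (c & H1 & H2).
- intros t Ht. apply is_derive_Reals. now apply Hd.
- specialize (Hp c H2). nra.
Qed.

Lemma deriv_lt0_decr (f df : R -> R) (a b : R) : a < b ->
  (forall t, a <= t <= b -> is_derive f t (df t)) ->
  (forall t, a < t < b -> df t < 0) -> f b < f a.
Proof.
intros Hab Hd Hp.
destruct (MVT_cor2 f df a b Hab) as (c & H1 & H2).
- intros t Ht. apply is_derive_Reals. now apply Hd.
- specialize (Hp c H2). nra.
Qed.

Lemma deriv_zero_const (f : R -> R) : (forall t, is_derive f t 0) -> forall a b, f a = f b.
Proof.
intros H.
assert (H1 : forall a b, a <= b -> f a = f b).
{ intros a b Hab. apply Rle_antisym.
  - apply (deriv_ge0_incr f (fun _ => 0)); intros; try apply H; lra.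
  - apply (deriv_le0_decr f (fun _ => 0)); intros; try apply H; lra. }
intros a b. destruct (Rle_dec a b); [ now apply H1 | symmetry; apply H1; lra ].
Qed.

(** The quantity [(N + K / C) exp (- C t)] does not increase. *)
Lemma gronwall (N dN : R -> R) (C K T : R) : 0 < C -> 0 <= K ->
  (forall t, 0 <= t <= T -> is_derive N t (dN t)) ->
  (forall t, 0 <= t <= T -> dN t <= C * N t + K) ->
  forall t, 0 <= t <= T -> N t <= (N 0 + K / C) * exp (C * t).
Proof.
intros HC HK Hd Hle t Ht.
assert (HKC : 0 <= K / C) by (apply Rdiv_le_0_compat; easy).
assert (H : (N t + K / C) * exp (- (C * t)) <= (N 0 + K / C) * exp (- (C * 0))).
{ apply (deriv_le0_decr (fun s => (N s + K / C) * exp (- (C * s)))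
    (fun s => (dN s - C * (N s + K / C)) * exp (- (C * s)))); [ lra | | ].
  - intros s Hs. assert (H1 := Hd s ltac:(lra)).
    replace ((dN s - C * (N s + K / C)) * exp (- (C * s))) with (dN s * exp (- (C * s)) + (N s + K / C) * (- C * exp (- (C * s)))) by ring.
    apply (is_derive_mult (fun s => N s + K / C) (fun s => exp (- (C * s)))); [ | | intros; apply Rmult_comm ].
    + replace (dN s) with (dN s + 0) by ring. apply (is_derive_plus (V := R_NormedModule)); [ easy | apply @is_derive_const ].
    + auto_derive; [ easy | ring ].
  - intros s Hs. assert (H1 := Hle s ltac:(lra)). assert (H2 := exp_pos (- (C * s))).
    assert (dN s - C * (N s + K / C) <= 0); [ | nra ].
    replace (C * (N s + K / C)) with (C * N s + K) by (field; lra). lra. }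
rewrite Rmult_0_r, Ropp_0, exp_0, Rmult_1_r, exp_Ropp in H.
assert (H2 := exp_pos (C * t)).
apply Rmult_le_compat_r with (r := exp (C * t)) in H; [ | lra ].
rewrite Rmult_assoc, Rinv_l, Rmult_1_r in H by lra. lra.
Qed.

(** Splits the cross terms in the derivative of a squared norm, as [gronwall] requires. *)
Lemma amgm_bound (k c u w : R) : - c <= k <= c -> k * (u * w) <= c / 2 * (u ^ 2 + w ^ 2).
Proof. intros H. generalize (pow2_ge_0 (u - w)) (pow2_ge_0 (u + w)). nra. Qed.

Ltac derive_known := repeat match goal with
  H : is_derive ?f ?t ?l |- context [Derive ?g ?t] =>
    replace (Derive g t) with l by (symmetry; apply is_derive_unique; exact H) end.

Definition flow (x y z : R -> R) : Prop := forall t,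
  is_derive x t (- (x t * z t)) /\ is_derive y t (y t * z t) /\
  is_derive z t (x t ^ 2 - y t ^ 2).

Lemma flow_shift_reverse (x y z : R -> R) (c : R) : flow x y z ->
  flow (fun t => y (c - t)) (fun t => x (c - t)) (fun t => z (c - t)).
Proof.
intros H t. destruct (H (c - t)) as (H1 & H2 & H3).
assert (Hl : forall (f : R -> R) (l : R), is_derive f (c - t) l -> is_derive (fun t : R => f (c - t)) t (- l)).
{ intros f l Hf. replace (- l) with (-1 * l) by ring. apply (is_derive_comp f (fun t => c - t)); [ easy | ].
  auto_derive; [ easy | ring ]. }
apply Hl in H1, H2, H3. split; [ | split ].
- exact H2.
- now rewrite Ropp_involutive in H1.
- now rewrite Ropp_minus_distr in H3.
Qed.

(** Time runs forward here. Composed with [flow_shift_reverse], this makes [x] and [y] even and [z]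
    odd along a geodesic that starts with [z = 0]. *)
Lemma flow_reverse_swap (x y z : R -> R) : flow x y z ->
  flow (fun t => y t) (fun t => x t) (fun t => - z t).
Proof.
intros H t. destruct (H t) as (H1 & H2 & H3). split; [ | split ].
- now replace (- (y t * - z t)) with (y t * z t) by ring.
- now replace (x t * - z t) with (- (x t * z t)) by ring.
- replace (y t ^ 2 - x t ^ 2) with (- (x t ^ 2 - y t ^ 2)) by ring.
  now apply (is_derive_opp (V := R_NormedModule)).
Qed.

Lemma flow_shift (x y z : R -> R) (c : R) : flow x y z ->
  flow (fun t => x (c + t)) (fun t => y (c + t)) (fun t => z (c + t)).
Proof.
intros H t. destruct (H (c + t)) as (H1 & H2 & H3).
assert (Hl : forall (f : R -> R) (l : R), is_derive f (c + t) l -> is_derive (fun t : R => f (c + t)) t l).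
{ intros f l Hf. replace l with (1 * l) by ring. apply (is_derive_comp f (fun t => c + t)); [ easy | ].
  auto_derive; [ easy | ring ]. }
apply Hl in H1, H2, H3. now split; [ | split ].
Qed.

Lemma flow_norm (x y z : R -> R) : flow x y z ->
  forall s t, x s ^ 2 + y s ^ 2 + z s ^ 2 = x t ^ 2 + y t ^ 2 + z t ^ 2.
Proof.
intros H. apply (deriv_zero_const (fun t => x t ^ 2 + y t ^ 2 + z t ^ 2)). intros t.
destruct (H t) as (H1 & H2 & H3). auto_derive.
- repeat split; eexists; eassumption.
- derive_known. ring.
Qed.

Lemma flow_prod (x y z : R -> R) : flow x y z -> forall s t, x s * y s = x t * y t.
Proof.
intros H. apply (deriv_zero_const (fun t => x t * y t)). intros t.
destruct (H t) as (H1 & H2 & H3). auto_derive.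
- repeat split; eexists; eassumption.
- derive_known. ring.
Qed.

Definition dist2 (x y z x' y' z' : R) : R := (x' - x) ^ 2 + (y' - y) ^ 2 + (z' - z) ^ 2.

Lemma unit_vector_bounds (x y z : R) : x ^ 2 + y ^ 2 + z ^ 2 = 1 ->
  -1 <= x <= 1 /\ -1 <= y <= 1 /\ -1 <= z <= 1.
Proof. intros H. repeat split; nra. Qed.

Lemma flow_dist (x y z x' y' z' : R -> R) : flow x y z -> flow x' y' z' ->
  x 0 ^ 2 + y 0 ^ 2 + z 0 ^ 2 = 1 -> x' 0 ^ 2 + y' 0 ^ 2 + z' 0 ^ 2 = 1 ->
  forall t, 0 <= t ->
  dist2 (x t) (y t) (z t) (x' t) (y' t) (z' t) <=
  dist2 (x 0) (y 0) (z 0) (x' 0) (y' 0) (z' 0) * exp (6 * t).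
Proof.
intros H H' Hn Hn' t Ht.
set (N := fun t => dist2 (x t) (y t) (z t) (x' t) (y' t) (z' t)).
change (N t <= N 0 * exp (6 * t)).
replace (N 0) with (N 0 + 0 / 6) by field.
set (dN := fun t => 2 * (x' t - x t) * (- (x' t * z' t) + x t * z t) + 2 * (y' t - y t) * (y' t * z' t - y t * z t)
  + 2 * (z' t - z t) * ((x' t ^ 2 - y' t ^ 2) - (x t ^ 2 - y t ^ 2))).
apply (gronwall N dN 6 0 t); try lra.
- intros s _. destruct (H s) as (H1 & H2 & H3), (H' s) as (H1' & H2' & H3').
  unfold N, dist2. auto_derive.
  + repeat split; eexists; eassumption.
  + derive_known.
    unfold dN. ring.
- intros s _. rewrite (flow_norm _ _ _ H 0 s) in Hn. rewrite (flow_norm _ _ _ H' 0 s) in Hn'.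
  destruct (unit_vector_bounds _ _ _ Hn) as (A1 & A2 & A3).
  destruct (unit_vector_bounds _ _ _ Hn') as (B1 & B2 & B3).
  unfold dN, N, dist2.
  assert (C1 := amgm_bound (- 2 * z' s) 2 (x' s - x s) (x' s - x s) ltac:(lra)).
  assert (C2 := amgm_bound (- 2 * x s + 2 * (x s + x' s)) 2 (x' s - x s) (z' s - z s) ltac:(lra)).
  assert (C3 := amgm_bound (2 * z' s) 2 (y' s - y s) (y' s - y s) ltac:(lra)).
  assert (C4 := amgm_bound (2 * y s - 2 * (y s + y' s)) 2 (y' s - y s) (z' s - z s) ltac:(lra)).
  generalize (pow2_ge_0 (x' s - x s)) (pow2_ge_0 (y' s - y s)) (pow2_ge_0 (z' s - z s)). lra.
Qed.

(** The symmetries of a geodesic follow by comparing it with its image under a symmetry of the flow.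
    Negative times are reduced to positive ones by time reversal. *)
Lemma flow_unique (x y z x' y' z' : R -> R) : flow x y z -> flow x' y' z' ->
  x 0 ^ 2 + y 0 ^ 2 + z 0 ^ 2 = 1 -> x 0 = x' 0 -> y 0 = y' 0 -> z 0 = z' 0 ->
  forall t, x t = x' t /\ y t = y' t /\ z t = z' t.
Proof.
assert (HP : forall x y z x' y' z', flow x y z -> flow x' y' z' ->
  x 0 ^ 2 + y 0 ^ 2 + z 0 ^ 2 = 1 -> x 0 = x' 0 -> y 0 = y' 0 -> z 0 = z' 0 ->
  forall t, 0 <= t -> x t = x' t /\ y t = y' t /\ z t = z' t).
{ clear. intros x y z x' y' z' H H' Hn Hx Hy Hz t Ht.
  assert (D := flow_dist x y z x' y' z' H H' Hn ltac:(now rewrite <- Hx, <- Hy, <- Hz) t Ht).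
  unfold dist2 in D. rewrite Hx, Hy, Hz in D.
  replace ((x' 0 - x' 0) ^ 2 + (y' 0 - y' 0) ^ 2 + (z' 0 - z' 0) ^ 2) with 0 in D by ring.
  generalize (pow2_ge_0 (x' t - x t)) (pow2_ge_0 (y' t - y t)) (pow2_ge_0 (z' t - z t)). intros.
  repeat split; nra. }
intros H H' Hn Hx Hy Hz t. destruct (Rle_dec 0 t) as [Ht|Ht]; [ now apply HP | ].
destruct (HP (fun t => y (0 - t)) (fun t => x (0 - t)) (fun t => z (0 - t)) (fun t => y' (0 - t)) (fun t => x' (0 - t)) (fun t => z' (0 - t))
  (flow_shift_reverse _ _ _ 0 H) (flow_shift_reverse _ _ _ 0 H')) with (t := - t) as (E1 & E2 & E3);
  rewrite ?Rminus_0_r; try easy; try lra.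
now replace (0 - - t) with t in * by ring.
Qed.

(** * Geodesics of parameter [al]: positivity, quarter period, reflections *)

Definition geodesic (al : R) (x y z : R -> R) : Prop :=
  small_param al /\ flow x y z /\ z 0 = 0 /\ x 0 * y 0 = al ^ 2 /\
  x 0 ^ 2 + y 0 ^ 2 = 1 /\ y 0 < x 0 /\ 0 < y 0.

Lemma geodesic_norm (al : R) (x y z : R -> R) : geodesic al x y z ->
  forall t, x t ^ 2 + y t ^ 2 + z t ^ 2 = 1.
Proof.
intros (_ & H & H0 & _ & H1 & _) t. rewrite (flow_norm _ _ _ H t 0), H0, H1. ring.
Qed.

Lemma geodesic_prod (al : R) (x y z : R -> R) : geodesic al x y z ->
  forall t, x t * y t = al ^ 2.
Proof. intros (_ & H & _ & H1 & _) t. now rewrite (flow_prod _ _ _ H t 0). Qed.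

(** The product [x y] is a nonzero constant, so by the intermediate value theorem [x] never changes
    sign. *)
Lemma geodesic_pos (al : R) (x y z : R -> R) : geodesic al x y z ->
  forall t, 0 < x t /\ 0 < y t.
Proof.
intros H t. assert (H1 := geodesic_prod _ _ _ _ H). destruct H as (Ha & H & _ & _ & _ & H2 & H3).
apply small_param_sq in Ha. destruct Ha as [Ha _]. assert (Ha2 : 0 < al ^ 2) by nra.
assert (Hx : 0 < x t).
{ apply Rnot_le_lt. intros Hx.
  destruct (IVT_gen x 0 t 0) as (s & _ & Hs).
  - intros s. apply ex_derive_continuity_pt. eexists. apply H.
  - split; [ apply Rle_trans with (x t); [ apply Rmin_r | easy ] | apply Rle_trans with (x 0); [ lra | apply Rmax_l ] ].
  - specialize (H1 s). rewrite Hs in H1. lra. }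
split; [ easy | ]. specialize (H1 t). nra.
Qed.

Lemma geodesic_z2 (al : R) (x y z : R -> R) : geodesic al x y z ->
  forall t, -1 < z t < 1.
Proof.
intros H t. assert (H1 := geodesic_norm _ _ _ _ H t). destruct (geodesic_pos _ _ _ _ H t) as [H2 H3].
split; nra.
Qed.

Lemma geodesic_even (al : R) (x y z : R -> R) : geodesic al x y z ->
  forall t, x (- t) = x t /\ y (- t) = y t /\ z (- t) = - z t.
Proof.
intros H t. assert (Hn := geodesic_norm _ _ _ _ H 0). destruct H as (_ & H & H0 & _).
destruct (flow_unique (fun t => x (0 - t)) (fun t => y (0 - t)) (fun t => - z (0 - t)) x y z) with (t := t) as (E1 & E2 & E3);
  rewrite ?Rminus_0_r; try easy.
- exact (flow_reverse_swap _ _ _ (flow_shift_reverse _ _ _ 0 H)).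
- rewrite H0 in *. rewrite <- Hn. ring.
- rewrite H0; ring.
- rewrite Rminus_0_l in *. repeat split; lra.
Qed.

Lemma flow_derive_D (x y z : R -> R) : flow x y z -> forall t,
  is_derive (fun t => x t ^ 2 - y t ^ 2) t (- 2 * z t * (x t ^ 2 + y t ^ 2)).
Proof.
intros H t. destruct (H t) as (H1 & H2 & H3). auto_derive.
- repeat split; eexists; eassumption.
- derive_known. ring.
Qed.

(* In the amplitude [s] the geodesic has [z = c * sin s] with [c^2 = 1 - 2 * al^2], and [dt/ds] is the integrand of [ell_int]. *)
Lemma geodesic_amplitude (al : R) (x y z : R -> R) : geodesic al x y z ->
  exists tau : R -> R, tau 0 = 0 /\ tau (PI / 2) = Lalpha al / 4 /\
  (forall s, continuity_pt tau s) /\ (forall s t, s < t -> tau s < tau t) /\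
  forall s, 0 <= s ->
    z (tau s) = sqrt (1 - 2 * al ^ 2) * sin s /\
    exists d, 0 < d /\ x (tau s) ^ 2 - y (tau s) ^ 2 = d * cos s.
Proof.
intros H. assert (HPI := PI_RGT_0).
assert (Hn := geodesic_norm _ _ _ _ H). assert (Hz2 := geodesic_z2 _ _ _ _ H).
destruct H as (Hal & Hf & Hz0 & Hp & Hn0 & Hxy & Hy0).
apply small_param_sq in Hal. destruct Hal as [Ha1 Ha2].
assert (Hb := sqrt_1_2sq_pos al). set (b := sqrt (1 + 2 * al ^ 2) / 2) in *.
assert (Hb2 : b ^ 2 = (1 + 2 * al ^ 2) / 4).
{ unfold b. replace ((sqrt (1 + 2 * al ^ 2) / 2) ^ 2) with ((sqrt (1 + 2 * al ^ 2)) ^ 2 / 4) by field. rewrite pow2_sqrt by nra. easy. }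
assert (Hc0 : 0 < 1 - 2 * al ^ 2) by lra.
assert (Hc := sqrt_lt_R0 _ Hc0). assert (Hc2 := pow2_sqrt _ (Rlt_le _ _ Hc0)).
set (c := sqrt (1 - 2 * al ^ 2)) in *.
(* Four times the form of [Lalpha], taken at [PI / 2 - u]; hence [tau (PI / 2)] is half of
   [ell_int], a quarter of the period. *)
set (g := fun u => (1 + 2 * al ^ 2) - c ^ 2 * sin u ^ 2).
assert (Hg : forall u, 2 * sqrt (ell_form al b (PI / 2 - u)) = sqrt (g u)).
{ intros u. transitivity (sqrt (2 ^ 2) * sqrt (ell_form al b (PI / 2 - u))); [ f_equal; now rewrite sqrt_pow2 by lra | ].
  rewrite <- sqrt_mult_alt by lra. f_equal.
  unfold ell_form, g. rewrite cos_shift, sin_shift, Hb2, Hc2. generalize (cos2_sin2 u). intros E.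
  replace (cos u ^ 2) with (1 - sin u ^ 2) by lra. field. }
assert (Hgp : forall u, 4 * al ^ 2 <= g u).
{ intros u. unfold g. rewrite Hc2. generalize (cos2_sin2 u) (pow2_ge_0 (cos u)) (pow2_ge_0 (sin u)). nra. }
assert (Hsg : forall u, 2 * al <= sqrt (g u)).
{ intros u. rewrite <- (sqrt_pow2 (2 * al)) by lra. apply sqrt_le_1_alt. generalize (Hgp u). lra. }
set (f := fun u => / sqrt (g u)).
assert (Hfc : forall u, continuous f u).
{ intros u. apply (ex_derive_continuous (V := R_NormedModule)). generalize (Hgp u) (Hsg u). unfold f, g. simpl pow. unfold Rminus. intros. auto_derive.
  assert (0 < al * (al * 1)) by nra.
  split; [ lra | split; [ apply Rgt_not_eq; lra | easy ] ]. }
assert (Hfi : forall p q, ex_RInt f p q) by (intros; apply (ex_RInt_continuous (V := R_CompleteNormedModule)); auto).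
set (tau := (fun s => RInt f 0 s) : R -> R).
assert (Htau : forall s, is_derive tau s (f s)).
{ intros s. apply (is_derive_RInt (V := R_NormedModule) f tau 0); [ | auto ].
  exists (mkposreal 1 ltac:(lra)). intros u _. apply (RInt_correct (V := R_CompleteNormedModule)). auto. }
assert (Hfp : forall s, 0 < f s).
{ intros s. apply Rinv_0_lt_compat. generalize (Hsg s). lra. }
assert (T0 : tau 0 = 0) by apply (RInt_point (V := R_CompleteNormedModule)).
exists tau. split; [ easy | ]. split.
{ rewrite Lalpha_ell_int by easy. fold b. unfold tau.
  assert (E := RInt_comp_lin (fun u => / sqrt (ell_form al b u)) (-1) (PI / 2) (PI / 2) 0 ltac:(now apply ex_RInt_ell)).
  replace (-1 * (PI / 2) + PI / 2) with 0 in E by ring. replace (-1 * 0 + PI / 2) with (PI / 2) in E by ring.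
  rewrite (RInt_ext _ (fun u => -2 * f u)) in E.
  2:{ intros u _. unfold f. rewrite <- Hg. replace (-1 * u + PI / 2) with (PI / 2 - u) by ring.
    change (-1 * / sqrt (ell_form al b (PI / 2 - u)) = -2 * / (2 * sqrt (ell_form al b (PI / 2 - u)))). field.
    apply Rgt_not_eq, sqrt_lt_R0. now apply ell_form_pos. }
  rewrite RInt_Rmult_l in E by auto. rewrite <- (opp_RInt_swap f) in E by auto.
  change (-2 * - RInt f 0 (PI / 2) = ell_int al b) in E. rewrite <- E. set (q := RInt f 0 (PI / 2) : R). change (q = 2 * (-2 * - q) / 4). field. }
split. { intros s. apply ex_derive_continuity_pt. now exists (f s). }
split. { intros s t Hst. apply (deriv_gt0_incr tau f); auto. }
intros s Hs.
assert (HD0 : (x 0 ^ 2 - y 0 ^ 2) = c * sqrt (1 + 2 * al ^ 2)).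
{ assert (Hd : 0 < 1 + 2 * al ^ 2) by nra. assert (Hd1 := sqrt_lt_R0 _ Hd). assert (Hd2 := pow2_sqrt _ (Rlt_le _ _ Hd)).
  set (d := sqrt (1 + 2 * al ^ 2)) in *.
  assert (E : (x 0 ^ 2 - y 0 ^ 2) ^ 2 = (c * d) ^ 2).
  { replace ((x 0 ^ 2 - y 0 ^ 2) ^ 2) with ((x 0 ^ 2 + y 0 ^ 2) ^ 2 - 4 * (x 0 * y 0) ^ 2) by ring.
    rewrite Hp, Hn0. replace ((c * d) ^ 2) with (c ^ 2 * d ^ 2) by ring. rewrite Hc2, Hd2. ring. }
  assert (0 < c * d) by nra. assert (0 < x 0 ^ 2 - y 0 ^ 2) by nra. nra. }
(* The conserved quantities give [z'^2 = (c^2 - z^2) (1 + 2 al^2 - z^2)], so [z = c sin u] should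
   come with [z' = c sqrt (g u) cos u]. [A] and [B] measure the failure of these two formulas; they
   solve a linear system with zero initial data. This avoids dividing by [cos u] at the turning
   point. *)
set (A := fun u => z (tau u) - c * sin u).
set (B := fun u => (x (tau u) ^ 2 - y (tau u) ^ 2) - c * sqrt (g u) * cos u).
assert (Hsq : forall u, sqrt (g u) ^ 2 = g u).
{ intros u. apply pow2_sqrt. generalize (Hgp u). nra. }
assert (HA : forall u, is_derive A u (B u / sqrt (g u))).
{ intros u. unfold A.
  replace (B u / sqrt (g u)) with (f u * (x (tau u) ^ 2 - y (tau u) ^ 2) - c * cos u).
  2:{ unfold B, f. field. generalize (Hsg u). lra. }
  apply (is_derive_minus (V := R_NormedModule) (fun u => z (tau u)) (fun u => c * sin u)).
  - apply (is_derive_comp z tau); [ apply Hf | apply Htau ].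
  - auto_derive; [ easy | ring ]. }
(* With [p = z] and [q = c sin u], the third factor is the quotient in [(p - p^3) - (q - q^3) = (p -
   q) (1 - p^2 - p q - q^2)]. *)
assert (HB : forall u, is_derive B u (-2 * A u * (1 - z (tau u) ^ 2 - z (tau u) * (c * sin u) - (c * sin u) ^ 2) / sqrt (g u))).
{ intros u. assert (Hs1 := Hsg u). assert (Hs2 := Hsq u). assert (Hg1 := Hgp u).
  replace (-2 * A u * (1 - z (tau u) ^ 2 - z (tau u) * (c * sin u) - (c * sin u) ^ 2) / sqrt (g u)) with
   (f u * (-2 * z (tau u) * (x (tau u) ^ 2 + y (tau u) ^ 2)) - (- 2 * (c * sin u) * (1 - (c * sin u) ^ 2) / sqrt (g u))).
  2:{ unfold A, f. replace (x (tau u) ^ 2 + y (tau u) ^ 2) with (1 - z (tau u) ^ 2) by (generalize (Hn (tau u)); lra). field. lra. }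
  apply (is_derive_minus (V := R_NormedModule) (fun u => x (tau u) ^ 2 - y (tau u) ^ 2) (fun u => c * sqrt (g u) * cos u)).
  - apply (is_derive_comp (fun t => x t ^ 2 - y t ^ 2) tau); [ now apply flow_derive_D | apply Htau ].
  - assert (Hg2 : 0 < g u) by nra.
    assert (Dg : is_derive (fun u => sqrt (g u)) u (- (2 * c ^ 2 * sin u * cos u) * / (2 * sqrt (g u)))).
    { apply (is_derive_comp sqrt g); [ now apply is_derive_Reals, derivable_pt_lim_sqrt | ].
      unfold g. auto_derive; [ easy | ring ]. }
    apply (is_derive_ext (fun u => sqrt (g u) * (c * cos u))); [ intros; eq_R; ring | ].
    replace (-2 * (c * sin u) * (1 - (c * sin u) ^ 2) / sqrt (g u)) with
      (- (2 * c ^ 2 * sin u * cos u) * / (2 * sqrt (g u)) * (c * cos u) + sqrt (g u) * (- c * sin u)).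
    { apply (is_derive_mult (fun u => sqrt (g u)) (fun u => c * cos u)); [ easy | | intros; apply Rmult_comm ].
      auto_derive; [ easy | ring ]. }
    set (r := sqrt (g u)) in *. unfold g in Hs2.
    transitivity (- c * sin u * (c ^ 2 * cos u ^ 2 + r ^ 2) / r); [ field; lra | rewrite Hs2 ].
    generalize (cos2_sin2 u). intros E. replace (cos u ^ 2) with (1 - sin u ^ 2) by lra.
    replace (al ^ 2) with ((1 - c ^ 2) / 2) by lra. field. lra. }
assert (HN : A s ^ 2 + B s ^ 2 <= (A 0 ^ 2 + B 0 ^ 2 + 0 / (9 / al)) * exp (9 / al * s)).
{ apply (gronwall (fun u => A u ^ 2 + B u ^ 2) (fun u => 2 * A u * (B u / sqrt (g u)) +
     2 * B u * (-2 * A u * (1 - z (tau u) ^ 2 - z (tau u) * (c * sin u) - (c * sin u) ^ 2) / sqrt (g u))) (9 / al) 0 s); try lra.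
  - apply Rdiv_lt_0_compat; lra.
  - intros u _. assert (H1 := HA u). assert (H2 := HB u). auto_derive.
    + split; [ eexists; exact H1 | split; [ eexists; exact H2 | easy ] ].
    + derive_known. ring.
  - intros u _. assert (Hs1 := Hsg u).
    set (k := 1 - z (tau u) ^ 2 - z (tau u) * (c * sin u) - (c * sin u) ^ 2).
    assert (Hk : -2 <= k <= 1.5).
    { assert (-1 <= c * sin u <= 1). { generalize (SIN_bound u). intros. assert (c <= 1) by nra. split; nra. }
      generalize (Hz2 (tau u)). unfold k. set (p := z (tau u)). set (q := c * sin u) in *. intros. split; nra. }
    assert (H1 := amgm_bound (2 - 4 * k) 18 (A u) (B u) ltac:(lra)).
    replace (2 * A u * (B u / sqrt (g u)) + 2 * B u * (-2 * A u * k / sqrt (g u))) with ((2 - 4 * k) * (A u * B u) / sqrt (g u)) by (field; lra).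
    apply Rle_trans with (18 / 2 * (A u ^ 2 + B u ^ 2) / sqrt (g u)).
    + apply Rmult_le_compat_r; [ left; apply Rinv_0_lt_compat; lra | easy ].
    + replace (9 / al * (A u ^ 2 + B u ^ 2) + 0) with (18 / 2 * (A u ^ 2 + B u ^ 2) / al) by (field; lra).
      apply Rmult_le_compat_l; [ generalize (pow2_ge_0 (A u)) (pow2_ge_0 (B u)); lra | ].
      apply Rinv_le_contravar; lra. }
assert (HA0 : A 0 = 0) by (unfold A; rewrite T0, sin_0, Hz0; ring).
assert (HB0 : B 0 = 0).
{ unfold B, g. rewrite T0, sin_0, cos_0, HD0. replace (1 + 2 * al ^ 2 - c ^ 2 * 0 ^ 2) with (1 + 2 * al ^ 2) by ring. ring. }
rewrite HA0, HB0 in HN. replace ((0 ^ 2 + 0 ^ 2 + 0 / (9 / al)) * exp (9 / al * s)) with 0 in HN by (field; lra).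
generalize (pow2_ge_0 (A s)) (pow2_ge_0 (B s)). intros.
assert (EA : A s = 0) by nra. assert (EB : B s = 0) by nra.
split; [ unfold A in EA; lra | ].
exists (c * sqrt (g s)). split; [ apply Rmult_lt_0_compat; [ easy | generalize (Hsg s); lra ] | unfold B in EB; lra ].
Qed.

(** The amplitude sweeps [[0, PI / 2]] during this time, so [x^2 - y^2] and [z] take the signs of
    [cos] and [sin]. *)
Lemma geodesic_quarter (al : R) (x y z : R -> R) : geodesic al x y z ->
  let T := Lalpha al / 4 in
  0 < T /\ x T = y T /\ (forall t, 0 <= t < T -> y t < x t) /\
  (forall t, 0 < t <= T -> 0 < z t).
Proof.
intros H T. assert (HPI := PI_RGT_0).
destruct (geodesic_amplitude _ _ _ _ H) as (tau & T0 & T1 & Tc & Tm & Hs). fold T in T1.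
assert (Hpos := geodesic_pos _ _ _ _ H).
assert (HT : 0 < T) by (rewrite <- T0, <- T1; apply Tm; lra).
assert (Hinv : forall t, 0 <= t <= T -> exists s, 0 <= s <= PI / 2 /\ tau s = t).
{ intros t Ht. destruct (IVT_gen tau 0 (PI / 2) t Tc) as (s & H1 & H2).
  - rewrite T0, T1, Rmin_left, Rmax_right; lra.
  - exists s. rewrite Rmin_left, Rmax_right in H1 by lra. easy. }
destruct H as (Hal & _). apply small_param_sq in Hal.
assert (Hc : 0 < sqrt (1 - 2 * al ^ 2)) by (apply sqrt_lt_R0; lra).
split; [ easy | ]. split; [ | split ].
- destruct (Hs (PI / 2) ltac:(lra)) as (_ & d & _ & E). rewrite T1, cos_PI2 in E. generalize (Hpos T). nra.
- intros t Ht. destruct (Hinv t ltac:(lra)) as (s & H1 & <-).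
  destruct (Hs s ltac:(lra)) as (_ & d & Hd & E).
  assert (s <> PI / 2) by (intros ->; lra).
  assert (0 < cos s) by (apply cos_gt_0; lra).
  assert (0 < d * cos s) by now apply Rmult_lt_0_compat.
  generalize (Hpos (tau s)). nra.
- intros t Ht. destruct (Hinv t ltac:(lra)) as (s & H1 & <-).
  destruct (Hs s ltac:(lra)) as (-> & _).
  assert (s <> 0) by (intros ->; lra).
  apply Rmult_lt_0_compat; [ easy | apply sin_gt_0; lra ].
Qed.

(** Since [x = y] at the quarter period, reversing time about it while exchanging [x] and [y]
    preserves the state there; uniqueness does the rest. *)
Lemma geodesic_reflect (al : R) (x y z : R -> R) : geodesic al x y z ->
  let T := Lalpha al / 4 in
  forall t, x (2 * T - t) = y t /\ y (2 * T - t) = x t /\ z (2 * T - t) = z t.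
Proof.
intros H T t. destruct (geodesic_quarter _ _ _ _ H) as (_ & HT & _). fold T in HT.
assert (Hn := geodesic_norm _ _ _ _ H T). destruct H as (_ & Hf & _).
destruct (flow_unique (fun s => x (T + s)) (fun s => y (T + s)) (fun s => z (T + s))
  (fun s => y (T - s)) (fun s => x (T - s)) (fun s => z (T - s))) with (t := T - t) as (E1 & E2 & E3);
  rewrite ?Rplus_0_r, ?Rminus_0_r; try easy.
- now apply flow_shift.
- now apply flow_shift_reverse.
- replace (T + (T - t)) with (2 * T - t) in * by ring. now replace (T - (T - t)) with t in * by ring.
Qed.

(** Stated as a reflection because the second half of the period is studied backwards, in terms of
    the time [u] that is left. *)
Lemma geodesic_period (al : R) (x y z : R -> R) : geodesic al x y z ->
  forall u, x (Lalpha al - u) = x u /\ y (Lalpha al - u) = y u /\ z (Lalpha al - u) = - z u.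
Proof.
intros H u. set (T := Lalpha al / 4).
destruct (geodesic_reflect _ _ _ _ H (- (2 * T - u))) as (A1 & A2 & A3).
destruct (geodesic_even _ _ _ _ H (2 * T - u)) as (B1 & B2 & B3).
destruct (geodesic_reflect _ _ _ _ H u) as (C1 & C2 & C3). fold T in A1, A2, A3, C1, C2, C3.
replace (2 * T - - (2 * T - u)) with (Lalpha al - u) in * by (unfold T; field).
rewrite A1, A2, A3, B1, B2, B3, C1, C2, C3. easy.
Qed.

(* [E] is the elliptic integral of the second kind along the geodesic *)
Definition geodesic_E (al : R) (x y z E : R -> R) : Prop :=
  geodesic al x y z /\ E 0 = 0 /\ forall t, is_derive E t (1 - z t ^ 2).

Lemma geodesic_E_derive_gap (al : R) (x y z E : R -> R) : geodesic_E al x y z E ->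
  forall t, is_derive (fun t => E t - z t) t (2 * y t ^ 2).
Proof.
intros (H & _ & HE) t. assert (Hn := geodesic_norm _ _ _ _ H t).
replace (2 * y t ^ 2) with ((1 - z t ^ 2) - (x t ^ 2 - y t ^ 2)) by lra.
apply (is_derive_minus (V := R_NormedModule)); [ easy | apply H ].
Qed.

Lemma geodesic_E_ge_z (al : R) (x y z E : R -> R) : geodesic_E al x y z E ->
  forall t, 0 <= t -> z t <= E t.
Proof.
intros H t Ht. assert (H1 := geodesic_E_derive_gap _ _ _ _ _ H).
destruct H as ((_ & _ & Hz & _) & HE0 & _).
assert (E 0 - z 0 <= E t - z t); [ | lra ].
apply (deriv_ge0_incr (fun t => E t - z t) (fun t => 2 * y t ^ 2)); [ easy | auto | ].
intros s _. generalize (pow2_ge_0 (y s)). lra.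
Qed.

Lemma geodesic_E_incr (al : R) (x y z E : R -> R) : geodesic_E al x y z E ->
  forall s t, s <= t -> E s <= E t.
Proof.
intros (H & _ & HE) s t Hst.
apply (deriv_ge0_incr E (fun t => 1 - z t ^ 2)); auto.
intros u _. generalize (geodesic_z2 _ _ _ _ H u). nra.
Qed.

Lemma geodesic_E_odd (al : R) (x y z E : R -> R) : geodesic_E al x y z E ->
  forall t, E (- t) = - E t.
Proof.
intros (H & H0 & HE) t. assert (Hev := geodesic_even _ _ _ _ H).
assert (E t + E (- t) = E 0 + E (- 0)); [ | rewrite Ropp_0 in *; lra ].
apply (deriv_zero_const (fun t => E t + E (- t))). intros s.
destruct (Hev s) as (_ & _ & Hz). assert (H1 := HE s). assert (H2 := HE (- s)).
auto_derive; [ split; [ eexists; exact H1 | split; [ eexists; exact H2 | easy ] ] | ].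
derive_known. rewrite Hz. ring.
Qed.

Lemma geodesic_E_reflect (al : R) (x y z E : R -> R) : geodesic_E al x y z E ->
  let T := Lalpha al / 4 in forall t, E (2 * T - t) = 2 * E T - E t.
Proof.
intros (H & H0 & HE) T t. assert (Hev := geodesic_reflect _ _ _ _ H).
assert (E t + E (2 * T - t) = E T + E (2 * T - T)); [ | replace (2 * T - T) with T in *; lra ].
apply (deriv_zero_const (fun t => E t + E (2 * T - t))). intros s.
destruct (Hev s) as (_ & _ & Hz). fold T in Hz. assert (H1 := HE s). assert (H2 := HE (2 * T - s)).
auto_derive; [ split; [ eexists; exact H1 | split; [ eexists; exact H2 | easy ] ] | ].
unfold Rminus in Hz, H2 |- *. derive_known. rewrite Hz. ring.
Qed.

Lemma geodesic_E_period (al : R) (x y z E : R -> R) : geodesic_E al x y z E ->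
  forall u, E (Lalpha al - u) = 4 * E (Lalpha al / 4) - E u.
Proof.
intros H u. set (T := Lalpha al / 4).
assert (A := geodesic_E_reflect _ _ _ _ _ H (- (2 * T - u))).
assert (B := geodesic_E_odd _ _ _ _ _ H (2 * T - u)).
assert (C := geodesic_E_reflect _ _ _ _ _ H u). fold T in A, C.
replace (2 * T - - (2 * T - u)) with (Lalpha al - u) in A by (unfold T; field). lra.
Qed.

(** * The sign of the variation of the endpoint *)

(* [var_w], [var_z] are the variations [v] of [ln (y / x) / 2] and [v'] of [z], with [s = n t]; [v'' = 2 D - 2 v (1 - z^2)] *)
Definition var_w (n s z D E : R) : R := (1 + n) * (z * E + D) - s * z.
Definition var_z (n s z D E : R) : R := (1 + n) * (D * E - z * (1 - z * z)) - (n * z + s * D).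
Definition var_end (n s z D E : R) : R := var_z n s z D E + var_w n s z D E * E - z.

(* [d/d(ln al)] of [var_end]: [n1], [s1], [z1], [E1], [D1], [v1] are the derivatives of [n], [s], [z], [E], [D], [v] *)
Definition var_end' (n s n1 s1 z D E : R) : R :=
  let v := var_w n s z D E in
  let z1 := var_z n s z D E in
  let E1 := E - v * z in
  let D1 := 2 * D - 2 * v * (1 - z * z) in
  let v1 := n1 * (z * E + D) + (1 + n) * (z1 * E + z * E1 + D1) - s1 * z - s * z1 in
  n1 * (D * E - z * (1 - z * z)) + (1 + n) * (D1 * E + D * E1 - z1 * (1 - 3 * (z * z)))
    - (n1 * z + s1 * D + n * z1 + s * D1) + v1 * E + v * E1 - z1.

(** * Error propagation with uniform constants *)

(** [x] is [x0] up to an error [C d], with [x0] of size at most [M]. The size is carried along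
    because the error of a product depends on it. *)
Definition approx (d x x0 C M : R) : Prop := Rabs (x - x0) <= C * d /\ Rabs x0 <= M /\ 0 <= C /\ 0 <= M.

Lemma approx_const (d c : R) : approx d c c 0 (Rabs c).
Proof.
unfold approx. rewrite Rminus_diag, Rabs_R0. generalize (Rabs_pos c). lra.
Qed.

Lemma approx_plus (d x x0 C M y y0 C' M' : R) : 0 <= d <= 1 ->
  approx d x x0 C M -> approx d y y0 C' M' -> approx d (x + y) (x0 + y0) (C + C') (M + M').
Proof.
intros Hd (H1 & H2 & H3 & H4) (K1 & K2 & K3 & K4). unfold approx.
replace (x + y - (x0 + y0)) with ((x - x0) + (y - y0)) by ring.
generalize (Rabs_triang (x - x0) (y - y0)) (Rabs_triang x0 y0). lra.
Qed.

Lemma approx_opp (d x x0 C M : R) : approx d x x0 C M -> approx d (- x) (- x0) C M.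
Proof.
unfold approx. replace (- x - - x0) with (- (x - x0)) by ring. now rewrite !Rabs_Ropp.
Qed.

Lemma approx_minus (d x x0 C M y y0 C' M' : R) : 0 <= d <= 1 ->
  approx d x x0 C M -> approx d y y0 C' M' -> approx d (x - y) (x0 - y0) (C + C') (M + M').
Proof. intros Hd H K. apply approx_plus; [ easy | easy | now apply approx_opp ]. Qed.

Lemma approx_mult (d x x0 C M y y0 C' M' : R) : 0 <= d <= 1 ->
  approx d x x0 C M -> approx d y y0 C' M' ->
  approx d (x * y) (x0 * y0) (C * (M' + C') + M * C') (M * M').
Proof.
intros Hd (H1 & H2 & H3 & H4) (K1 & K2 & K3 & K4).
assert (Hp : forall a b c e, Rabs a <= c -> Rabs b <= e -> Rabs (a * b) <= c * e).
{ intros. rewrite Rabs_mult. apply Rmult_le_compat; auto using Rabs_pos. }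
assert (A1 : Rabs y <= M' + C').
{ replace y with (y0 + (y - y0)) by ring. generalize (Rabs_triang y0 (y - y0)). nra. }
split; [ | split; [ auto | split; nra ] ].
replace (x * y - x0 * y0) with ((x - x0) * y + x0 * (y - y0)) by ring.
generalize (Rabs_triang ((x - x0) * y) (x0 * (y - y0))) (Hp _ _ _ _ H1 A1) (Hp _ _ _ _ H2 K1). nra.
Qed.

Ltac approx_tac := repeat first
  [ eassumption | eapply approx_plus | eapply approx_minus | eapply approx_mult | eapply approx_opp | eapply approx_const ].

Lemma approx_small (d x C : R) : 0 <= C -> Rabs x <= C * d -> approx d x 0 C 0.
Proof. intros HC H. unfold approx. rewrite Rminus_0_r, Rabs_R0. lra. Qed.

Lemma approx_bound (d x x0 C M : R) : approx d x x0 C M -> Rabs (x - x0) <= C * d.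
Proof. now intros [H _]. Qed.

Lemma approx_atoms (d c n s D E : R) : 0 <= d <= 1 -> 0 <= c <= 1 ->
  Rabs n <= d -> Rabs s <= d -> Rabs (D - (1 - c * c)) <= d -> Rabs (E - (4 - c)) <= 10 * d ->
  approx d n 0 1 0 /\ approx d s 0 1 0 /\ approx d D (1 - c * c) 1 1 /\ approx d E (4 - c) 10 4 /\
  approx d (- c) (- c) 0 1.
Proof.
intros Hd Hc Hn Hs HD HE. split; [ apply approx_small; lra | ]. split; [ apply approx_small; lra | ].
split; [ repeat split; try lra; apply Rabs_le; nra | ].
split; [ repeat split; try lra; apply Rabs_le; lra | ].
repeat split; try lra; [ rewrite Rminus_diag, Rabs_R0; lra | apply Rabs_le; lra ].
Qed.

(** In the limit [al -> 0], with [c] the value of [z] at the time left, the arguments are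
    [n = s = 0], [z = - c], [D = 1 - c^2] and [E = 4 - c], and there [var_end] is exactly
    [8 - 16 c]. *)
Lemma var_end_approx : exists C, forall d c n s D E, 0 <= d <= 1 -> 0 <= c <= 1 ->
  Rabs n <= d -> Rabs s <= d -> Rabs (D - (1 - c * c)) <= d -> Rabs (E - (4 - c)) <= 10 * d ->
  Rabs (var_end n s (- c) D E - (8 - 16 * c)) <= C * d.
Proof.
(* The constant is an existential variable created before the data, so [approx_tac] can fill it only
   with a number: the bound is uniform. *)
eexists. intros d c n s D E Hd Hc Hn Hs HD HE.
destruct (approx_atoms d c n s D E Hd Hc Hn Hs HD HE) as (An & As & AD & AE & Ac). clear Hn Hs HD HE.
replace (8 - 16 * c) with (var_end 0 0 (- c) (1 - c * c) (4 - c)) by (unfold var_end, var_z, var_w; ring).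
set (q := - c) in *. set (D0 := 1 - c * c) in *. set (E0 := 4 - c) in *.
unfold var_end, var_z, var_w. eapply approx_bound. approx_tac.
Qed.

Lemma var_end'_approx : exists C, forall d c n s n1 s1 D E, 0 <= d <= 1 -> 0 <= c <= 1 ->
  Rabs n <= d -> Rabs s <= d -> Rabs n1 <= d -> Rabs s1 <= d ->
  Rabs (D - (1 - c * c)) <= d -> Rabs (E - (4 - c)) <= 10 * d ->
  Rabs (var_end' n s n1 s1 (- c) D E - 64 * (1 - c * c)) <= C * d.
Proof.
eexists. intros d c n s n1 s1 D E Hd Hc Hn Hs Hn1 Hs1 HD HE.
destruct (approx_atoms d c n1 s1 D E Hd Hc Hn1 Hs1 HD HE) as (An1 & As1 & _).
destruct (approx_atoms d c n s D E Hd Hc Hn Hs HD HE) as (An & As & AD & AE & Ac).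
clear Hn Hs Hn1 Hs1 HD HE.
replace (64 * (1 - c * c)) with (var_end' 0 0 0 0 (- c) (1 - c * c) (4 - c)) by (unfold var_end', var_z, var_w; ring).
set (q := - c) in *. set (D0 := 1 - c * c) in *. set (E0 := 4 - c) in *.
unfold var_end', var_z, var_w. cbv zeta. eapply approx_bound. approx_tac.
Qed.

(** Equal to [1 / D(0)^2 - 1], where [D(0)^2 = 1 - 4 al^4]; it is not the nome of elliptic function
    theory. *)
Definition nome (al : R) : R := 4 * al ^ 4 / (1 - 4 * al ^ 4).

Definition end_at (al : R) (x y z E : R -> R) (t : R) : R :=
  var_end (nome al) (nome al * t) (z t) (x t ^ 2 - y t ^ 2) (E t).

Lemma nome_bounds (al : R) : 0 < al <= 1 / 10 -> 0 < nome al <= 5 * al ^ 4.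
Proof.
intros H. unfold nome. assert (H1 : 0 < al ^ 2 <= 1 / 100) by nra.
assert (H2 : 0 < al ^ 4 <= 1 / 10000) by (replace (al ^ 4) with (al ^ 2 * al ^ 2) by ring; nra).
split; [ apply Rdiv_lt_0_compat; lra | ].
apply Rmult_le_reg_r with (1 - 4 * al ^ 4); [ lra | ]. field_simplify; [ | lra ]. nra.
Qed.

Lemma small_param_le (al : R) : 0 < al <= 1 / 10 -> small_param al.
Proof. intros H. apply small_param_sq. nra. Qed.

Lemma Lalpha_al (al : R) : 0 < al <= 1 / 10 -> Lalpha al * al <= 4.
Proof.
intros H. assert (H1 := Lalpha_upper al (small_param_le al H)). assert (HPI := PI_4).
apply Rmult_le_compat_r with (r := al) in H1; [ | lra ]. field_simplify in H1; lra.
Qed.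

(** The time can be as large as [4 / al], which costs one power of [al]. *)
Lemma nome_time (al t : R) : 0 < al <= 1 / 10 -> 0 <= t <= Lalpha al -> 0 <= nome al * t <= 20 * al ^ 3.
Proof.
intros H Ht. assert (H1 := Lalpha_al al H). destruct (nome_bounds al H) as [H2 H3].
split; [ nra | ].
apply Rle_trans with (5 * al ^ 4 * t); [ nra | ].
replace (5 * al ^ 4 * t) with (5 * al ^ 3 * (t * al)) by ring.
replace (20 * al ^ 3) with (5 * al ^ 3 * 4) by ring.
assert (0 < al ^ 3) by (apply pow_lt; lra). apply Rmult_le_compat_l; [ lra | nra ].
Qed.

(** * Estimates along one geodesic of small parameter *)

Section Estimates.
Context (al : R) (x y z E : R -> R) (Hg : geodesic_E al x y z E) (Hal : 0 < al <= 1 / 1000).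
Let T := Lalpha al / 4.
Let D t := x t ^ 2 - y t ^ 2.
Let n := nome al.

Let al10 : 0 < al <= 1 / 10. Proof. lra. Qed.
Let HT : 0 < T. Proof. exact (proj1 (geodesic_quarter _ _ _ _ (proj1 Hg))). Qed.

Lemma D_sq (t : R) : D t ^ 2 = (1 - z t ^ 2) ^ 2 - 4 * al ^ 4.
Proof.
assert (Hn := geodesic_norm _ _ _ _ (proj1 Hg) t). assert (Hp := geodesic_prod _ _ _ _ (proj1 Hg) t).
unfold D. replace ((x t ^ 2 - y t ^ 2) ^ 2) with ((x t ^ 2 + y t ^ 2) ^ 2 - 4 * (x t * y t) ^ 2) by ring.
rewrite Hp. replace (x t ^ 2 + y t ^ 2) with (1 - z t ^ 2) by lra. ring.
Qed.

Lemma D_0_pos : 0 < D 0.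
Proof. destruct Hg as ((_ & _ & _ & _ & _ & H1 & H2) & _). unfold D. nra. Qed.

Lemma nome_D0 : (1 + n) * D 0 ^ 2 = 1.
Proof.
rewrite D_sq. destruct Hg as ((_ & _ & -> & _) & _). unfold n, nome. field.
apply Rgt_not_eq. assert (H1 : 0 < al ^ 2 <= 1 / 100) by nra.
assert (H2 : 0 < al ^ 4 <= 1 / 10000) by (replace (al ^ 4) with (al ^ 2 * al ^ 2) by ring; nra). lra.
Qed.

Lemma D_le (t : R) : D t <= 1 - z t ^ 2.
Proof. generalize (geodesic_norm _ _ _ _ (proj1 Hg) t) (pow2_ge_0 (y t)). unfold D. lra. Qed.

Lemma D_pos (t : R) : 0 <= t <= T -> 0 <= D t.
Proof.
intros Ht. destruct (geodesic_quarter _ _ _ _ (proj1 Hg)) as (_ & H1 & H2 & _). fold T in H1, H2.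
unfold D. destruct (Req_dec t T) as [->|Hne]; [ rewrite H1; lra | ].
specialize (H2 t ltac:(lra)). generalize (geodesic_pos _ _ _ _ (proj1 Hg) t). nra.
Qed.

Lemma z_half (t : R) : z (2 * T - t) = z t.
Proof. apply (geodesic_reflect _ _ _ _ (proj1 Hg)). Qed.

Lemma D_half (t : R) : D (2 * T - t) = - D t.
Proof. destruct (geodesic_reflect _ _ _ _ (proj1 Hg) t) as (H1 & H2 & _). fold T in H1, H2. unfold D. rewrite H1, H2. ring. Qed.

Lemma D_neg (t : R) : T <= t <= 2 * T -> D t <= 0.
Proof. intros Ht. assert (H := D_pos (2 * T - t) ltac:(lra)). rewrite D_half in H. lra. Qed.

Lemma z_pos (t : R) : 0 < t < 2 * T -> 0 < z t.
Proof.
intros Ht. destruct (geodesic_quarter _ _ _ _ (proj1 Hg)) as (_ & _ & _ & H). fold T in H.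
destruct (Rle_dec t T); [ apply H; lra | ]. rewrite <- z_half. apply H; lra.
Qed.

Lemma z_nonneg (t : R) : 0 <= t <= 2 * T -> 0 <= z t.
Proof.
intros Ht. destruct Hg as ((_ & _ & Hz & _) & _).
destruct (Req_dec t 0) as [->|H0]; [ lra | ].
destruct (Req_dec t (2 * T)) as [->|H1].
- rewrite <- z_half. replace (2 * T - 2 * T) with 0 by ring. lra.
- left. apply z_pos. lra.
Qed.

Lemma derive_z (t : R) : is_derive z t (D t).
Proof. apply Hg. Qed.

Lemma derive_D (t : R) : is_derive D t (- 2 * z t * (1 - z t ^ 2)).
Proof.
replace (1 - z t ^ 2) with (x t ^ 2 + y t ^ 2) by (generalize (geodesic_norm _ _ _ _ (proj1 Hg) t); lra).
apply flow_derive_D. apply Hg.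
Qed.

Lemma derive_E (t : R) : is_derive E t (1 - z t ^ 2).
Proof. apply Hg. Qed.

(** The main part of the variation: [vv = (1 + n) qq - n t z]. Its derivative is [pp]. *)
Definition qq (t : R) : R := z t * E t + D t.
Definition pp (t : R) : R := D t * E t - z t * (1 - z t ^ 2).

Lemma derive_qq (t : R) : is_derive qq t (pp t).
Proof.
assert (H1 := derive_z t). assert (H2 := derive_D t). assert (H3 := derive_E t).
unfold qq, pp. auto_derive.
- split; [ eexists; exact H1 | split; [ eexists; exact H3 | split; [ eexists; exact H2 | easy ] ] ].
- derive_known. ring.
Qed.

(** [pp] starts at 0 and [pp' = - 2 z ((1 - z^2) E - z D)], where [z >= 0], [E >= z] and
    [D <= 1 - z^2]. *)
Lemma pp_le0 (t : R) : 0 <= t <= 2 * T -> pp t <= 0.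
Proof.
intros Ht.
assert (H0 : pp 0 = 0). { unfold pp. destruct Hg as ((_ & _ & -> & _) & -> & _). ring. }
rewrite <- H0.
apply (deriv_le0_decr pp (fun s => -2 * z s * ((1 - z s ^ 2) * E s - z s * D s))); [ lra | | ].
- intros s _. assert (H1 := derive_z s). assert (H2 := derive_D s). assert (H3 := derive_E s).
  unfold pp. auto_derive.
  + repeat split; try easy; eexists; [ exact H2 | exact H3 | exact H1 | exact H1 ].
  + derive_known. ring.
- intros s Hs. assert (H1 := z_nonneg s ltac:(lra)). assert (H2 := geodesic_E_ge_z _ _ _ _ _ Hg s ltac:(lra)).
  assert (H3 := D_le s). assert (H4 := geodesic_z2 _ _ _ _ (proj1 Hg) s).
  assert (0 <= (1 - z s ^ 2) * (E s - z s)) by (apply Rmult_le_pos; nra).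
  assert (0 <= z s * (1 - z s ^ 2 - D s)) by (apply Rmult_le_pos; lra).
  assert (0 <= (1 - z s ^ 2) * E s - z s * D s) by lra. nra.
Qed.

Lemma z_T_sq : z T ^ 2 = 1 - 2 * al ^ 2.
Proof.
assert (H := geodesic_norm _ _ _ _ (proj1 Hg) T). assert (Hp := geodesic_prod _ _ _ _ (proj1 Hg) T).
destruct (geodesic_quarter _ _ _ _ (proj1 Hg)) as (_ & H1 & _). fold T in H1. rewrite H1 in *. nra.
Qed.

Lemma z_T : 1 - 2 * al ^ 2 <= z T <= 1.
Proof.
assert (H := z_T_sq). assert (H1 := z_pos T ltac:(lra)). split; nra.
Qed.

Lemma y_small (t : R) : 0 <= t <= T -> 0 <= y t ^ 2 <= al ^ 2.
Proof.
intros Ht. assert (H := D_pos t Ht). assert (Hp := geodesic_prod _ _ _ _ (proj1 Hg) t).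
destruct (geodesic_pos _ _ _ _ (proj1 Hg) t). unfold D in H. split; nra.
Qed.

(** [E - z] grows at rate [2 y^2 <= 2 al^2] during a time of at most [1 / al]. *)
Lemma E_gap (t : R) : 0 <= t <= T -> 0 <= E t - z t <= 2 * al.
Proof.
intros Ht. split; [ generalize (geodesic_E_ge_z _ _ _ _ _ Hg t); lra | ].
assert (H1 := geodesic_E_derive_gap _ _ _ _ _ Hg).
assert (H : E t - z t - 2 * al ^ 2 * t <= E 0 - z 0 - 2 * al ^ 2 * 0).
{ apply (deriv_le0_decr (fun t => E t - z t - 2 * al ^ 2 * t) (fun t => 2 * y t ^ 2 - 2 * al ^ 2)); [ easy | | ].
  - intros s _. apply (is_derive_minus (V := R_NormedModule) (fun t => E t - z t) (fun t => 2 * al ^ 2 * t)); [ apply H1 | ].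
    auto_derive; [ easy | ring ].
  - intros s Hs. generalize (y_small s ltac:(lra)). lra. }
destruct Hg as ((_ & _ & Hz & _) & HE & _). rewrite Hz, HE in H.
assert (H2 := Lalpha_al al al10). assert (t * al <= 1) by (unfold T in Ht; nra). nra.
Qed.

Lemma E_T : - al <= E T - 1 <= 2 * al.
Proof. generalize (E_gap T ltac:(lra)) z_T. nra. Qed.

Let n_small : 0 < n <= al.
Proof.
destruct (nome_bounds al al10). unfold n. split; [ easy | ].
assert (0 < al ^ 2 <= 1) by nra. replace (al ^ 4) with (al * (al * al ^ 2)) in * by ring. nra.
Qed.

Let nt_small (t : R) : 0 <= t <= 4 * T -> 0 <= n * t <= al.
Proof.
intros Ht. destruct (nome_time al t al10 ltac:(unfold T in Ht; lra)). unfold n. split; [ easy | ].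
assert (0 < al ^ 2 <= 1 / 20) by nra. replace (al ^ 3) with (al * al ^ 2) in * by ring. nra.
Qed.

Let vv t := var_w n (n * t) (z t) (D t) (E t).
Let vd t := var_z n (n * t) (z t) (D t) (E t).

Lemma derive_vv (t : R) : is_derive vv t (vd t).
Proof.
assert (H1 := derive_z t). assert (H2 := derive_qq t).
apply (is_derive_ext (fun t => (1 + n) * qq t - n * t * z t)); [ easy | ].
auto_derive.
- split; [ eexists; exact H2 | split; [ eexists; exact H1 | easy ] ].
- derive_known. unfold vd, var_z, pp. ring.
Qed.

(** Up to [T] all terms are nonpositive by [pp_le0], and [- n z] is strictly negative. After [T] the
    term [- n t D] has the wrong sign, but [E >= 0.9] outweighs [n t <= al]. *)
Lemma vd_lt0 (t : R) : 0 < t <= 2 * T -> vd t < 0.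
Proof.
intros Ht. assert (H1 := pp_le0 t ltac:(lra)). assert (H2 := z_nonneg t ltac:(lra)).
assert (H3 := geodesic_z2 _ _ _ _ (proj1 Hg) t). assert (H4 := n_small). assert (H5 := nt_small t ltac:(lra)).
destruct (Rle_dec t T) as [Hle|Hgt].
- assert (H6 := D_pos t ltac:(lra)). assert (H7 := z_pos t ltac:(lra)).
  unfold vd, var_z.
  replace (D t * E t - z t * (1 - z t * z t)) with (pp t) by (unfold pp; ring).
  assert (0 < n * z t) by nra. assert (0 <= n * t * D t) by nra. nra.
- assert (H6 := D_neg t ltac:(lra)). assert (H7 := geodesic_E_incr _ _ _ _ _ Hg T t ltac:(lra)). assert (H8 := E_T).
  assert (HE : 0.9 <= E t) by lra.
  assert (A1 : D t * ((1 + n) * E t - n * t) <= 0).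
  { assert (0 < (1 + n) * E t - n * t) by nra. nra. }
  assert (A2 : 0 <= z t * (1 - z t * z t)) by (assert (0 < 1 - z t * z t) by nra; nra).
  assert (A3 : vd t = D t * ((1 + n) * E t - n * t) - (1 + n) * (z t * (1 - z t * z t)) - n * z t) by (unfold vd, var_z; ring).
  destruct (Rle_lt_or_eq_dec _ _ H2) as [Hz|Hz].
  + assert (0 < n * z t) by nra. nra.
  + assert (D t < 0). { generalize (D_sq t). rewrite <- Hz. assert (0 < al ^ 2 <= 1 / 100) by nra. replace (al ^ 4) with (al ^ 2 * al ^ 2) by ring. nra. }
    assert (0 < (1 + n) * E t - n * t) by nra.
    rewrite <- Hz in A3. nra.
Qed.

(* The relation [z v' - z' v = - (1 - z^2)] is the variation of the conserved energy. *)
Lemma end_at_mul_z (t : R) : z t * end_at al x y z E t = vv t * qq t - 1.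
Proof.
unfold end_at. fold n. fold (D t). unfold var_end, vv, var_w, var_z, qq.
assert (H := D_sq t). assert (Hm : n * (1 - 4 * al ^ 4) = 4 * al ^ 4).
{ unfold n, nome. field. assert (H1 : 0 < al ^ 2 <= 1 / 100) by nra. replace (al ^ 4) with (al ^ 2 * al ^ 2) by ring. nra. }
assert (H2 : (1 + n) * D t ^ 2 = (1 + n) * (1 - z t ^ 2) ^ 2 - n).
{ rewrite H. lra. }
apply Rminus_diag_uniq.
transitivity ((1 + n) * (1 - z t ^ 2) ^ 2 - n - (1 + n) * D t ^ 2); [ ring | rewrite H2; ring ].
Qed.

(** By [end_at_mul_z] it is enough that [vv qq < 1]. Over [[0, 2 T]], [vv] decreases strictly from
    [k] to [- k] and [qq] decreases from [D 0] to [- D 0], where [k D(0) = 1]. At [2 T] itself [z]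
    vanishes and the value is computed directly. *)
Lemma end_at_neg_half (t : R) : 0 < t <= 2 * T -> end_at al x y z E t < 0.
Proof.
intros Ht. assert (D0 := D_0_pos). assert (HD0 := nome_D0).
assert (Hz0 : z 0 = 0) by apply Hg. assert (HE0 : E 0 = 0) by apply Hg.
assert (Hz2T : z (2 * T) = 0) by (rewrite <- z_half, <- Hz0; f_equal; ring).
assert (HD2T : D (2 * T) = - D 0) by (rewrite <- D_half; f_equal; ring).
assert (V0 : vv 0 = (1 + n) * D 0) by (unfold vv, var_w; rewrite Hz0, HE0; ring).
assert (V2 : vv (2 * T) = - ((1 + n) * D 0)) by (unfold vv, var_w; rewrite Hz2T, HD2T; ring).
assert (Q0 : qq 0 = D 0) by (unfold qq; rewrite Hz0, HE0; ring).
assert (Q2 : qq (2 * T) = - D 0) by (unfold qq; rewrite Hz2T, HD2T; ring).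
destruct (Req_dec t (2 * T)) as [->|Hne].
- assert (H1 := vd_lt0 (2 * T) ltac:(lra)). assert (H2 := geodesic_E_incr _ _ _ _ _ Hg T (2 * T) ltac:(lra)). assert (H3 := E_T).
  change (vd (2 * T) + vv (2 * T) * E (2 * T) - z (2 * T) < 0). rewrite V2, Hz2T. assert (H4 := n_small). assert (0 < (1 + n) * D 0) by nra. nra.
- assert (A1 : vv t < vv 0).
  { apply (deriv_lt0_decr vv vd); [ lra | intros; apply derive_vv | intros; apply vd_lt0; lra ]. }
  assert (A2 : vv (2 * T) < vv t).
  { apply (deriv_lt0_decr vv vd); [ lra | intros; apply derive_vv | intros; apply vd_lt0; lra ]. }
  assert (B1 : qq t <= qq 0).
  { apply (deriv_le0_decr qq pp); [ lra | intros; apply derive_qq | intros; apply pp_le0; lra ]. }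
  assert (B2 : qq (2 * T) <= qq t).
  { apply (deriv_le0_decr qq pp); [ lra | intros; apply derive_qq | intros; apply pp_le0; lra ]. }
  assert (Hz := z_pos t ltac:(lra)). assert (HF := end_at_mul_z t).
  assert (HP : vv t * qq t < 1).
  { rewrite V0 in A1. rewrite V2 in A2. rewrite Q0 in B1. rewrite Q2 in B2. set (k := (1 + n) * D 0) in *.
    assert (Hk : k * D 0 = 1) by (unfold k; lra).
    destruct (Rle_dec 0 (qq t)), (Rle_dec 0 (vv t)); nra. }
  nra.
Qed.

(** In terms of the time left, [var_end] is [D] times a positive factor minus [z] times a positive
    factor, with [D <= 0 <= z] not both zero. The factors are positive because [E] now exceeds
    1.9. *)
Lemma end_at_neg_third_quarter (t : R) : 2 * T <= t <= 3 * T -> end_at al x y z E t < 0.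
Proof.
intros Ht. set (u := 4 * T - t). assert (Hu : T <= u <= 2 * T) by (unfold u; lra).
destruct (geodesic_period _ _ _ _ (proj1 Hg) u) as (Px & Py & Pz).
assert (PE := geodesic_E_period _ _ _ _ _ Hg u). fold T in PE.
replace (Lalpha al - u) with t in * by (unfold u, T; field).
unfold end_at. rewrite Px, Py, Pz, PE. fold n. fold (D u).
assert (H1 := z_nonneg u ltac:(lra)). assert (H2 := D_neg u Hu). assert (H3 := E_T).
assert (H4 := n_small). assert (H5 := nt_small t ltac:(lra)).
assert (H6 := geodesic_z2 _ _ _ _ (proj1 Hg) u).
assert (H7 := geodesic_E_incr _ _ _ _ _ Hg u (2 * T) ltac:(lra)).
assert (H8 := geodesic_E_incr _ _ _ _ _ Hg T u ltac:(lra)).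
assert (H9 := geodesic_E_reflect _ _ _ _ _ Hg 0). fold T in H9. rewrite Rminus_0_r in H9.
assert (HE0 : E 0 = 0) by apply Hg. rewrite HE0 in H9.
assert (HD := D_sq u). assert (HzD : 0 < z u \/ D u < 0).
{ destruct (Rle_lt_or_eq_dec _ _ H1) as [Hz|Hz]; [ now left | right ].
  rewrite <- Hz in HD. assert (0 < al ^ 2 <= 1 / 100) by nra. replace (al ^ 4) with (al ^ 2 * al ^ 2) in HD by ring. nra. }
set (w := 4 * E T - E u). assert (Hw : 1.9 <= w <= 4) by (unfold w; lra).
set (s := n * t) in *. set (d := D u) in *. set (c := z u) in *.
replace (var_end n s (- c) d w) with (d * (2 * (1 + n) * w - s) - c * ((1 + n) * (w ^ 2 - (1 - c ^ 2)) - 1 - n - s * w)) by (unfold var_end, var_z, var_w; ring).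
assert (A1 : 0 < 2 * (1 + n) * w - s) by nra.
assert (A2 : 0 < (1 + n) * (w ^ 2 - (1 - c ^ 2)) - 1 - n - s * w).
{ assert (2.6 <= w ^ 2 - (1 - c ^ 2)) by nra. assert (s * w <= 0.1) by nra. nra. }
destruct HzD; nra.
Qed.
Lemma z_le_id (u : R) : 0 <= u -> z u <= u.
Proof.
intros Hu. assert (Hz0 : z 0 = 0) by apply Hg. assert (z u - u <= z 0 - 0); [ | lra ].
apply (deriv_le0_decr (fun u => z u - u) (fun u => D u - 1)); [ easy | | ].
- intros s _. apply (is_derive_minus (V := R_NormedModule) z (fun u => u)); [ apply derive_z | apply @is_derive_id ].
- intros s _. generalize (D_le s) (pow2_ge_0 (z s)). lra.
Qed.

(** Taylor bound for the limit profile [tanh u], corrected for [y^2 <= al^2]. At [u = 9/10] it gives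
    [z > 0.65], past the zero [1/2] of [8 - 16 z]. *)
Lemma z_lower (u : R) : 0 <= u <= T -> u - u ^ 3 / 3 - 2 * al ^ 2 * u <= z u.
Proof.
intros Hu. assert (Hz0 : z 0 = 0) by apply Hg.
assert (0 - 0 ^ 3 / 3 - 2 * al ^ 2 * 0 - z 0 >= u - u ^ 3 / 3 - 2 * al ^ 2 * u - z u); [ | lra ].
apply Rle_ge.
apply (deriv_le0_decr (fun u => u - u ^ 3 / 3 - 2 * al ^ 2 * u - z u) (fun u => 1 - u ^ 2 - 2 * al ^ 2 - D u)); [ lra | | ].
- intros s _. apply (is_derive_minus (V := R_NormedModule) (fun u => u - u ^ 3 / 3 - 2 * al ^ 2 * u) z); [ | apply derive_z ].
  auto_derive; [ easy | field ].
- intros s Hs. assert (H1 := z_le_id s ltac:(lra)). assert (H2 := z_nonneg s ltac:(lra)).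
  assert (H3 := y_small s ltac:(lra)). assert (H4 := geodesic_norm _ _ _ _ (proj1 Hg) s). unfold D. nra.
Qed.

(** Supplies the hypotheses of [var_end_approx] and [var_end'_approx] with [d = al] and [c = z u];
    [4 n (1 + n)] is the derivative of [n] in [ln al]. *)
Lemma last_quarter_args (u : R) : 0 <= u <= T ->
  let t := Lalpha al - u in
  0 <= z u <= 1 /\ z t = - z u /\ Rabs (n * t) <= al /\ Rabs n <= al /\
  Rabs (4 * n * (1 + n)) <= al /\ Rabs (4 * n * (1 + n) * t) <= al /\
  Rabs (D t - (1 - z u * z u)) <= al /\ Rabs (E t - (4 - z u)) <= 10 * al.
Proof.
intros Hu t. destruct (geodesic_period _ _ _ _ (proj1 Hg) u) as (Px & Py & Pz).
assert (PE := geodesic_E_period _ _ _ _ _ Hg u). fold t in Px, Py, Pz, PE. fold T in PE.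
assert (Ht : 0 <= t <= Lalpha al) by (unfold t, T in *; lra).
destruct (nome_bounds al al10) as [N1 N2]. destruct (nome_time al t al10 Ht) as [N3 N4]. fold n in N1, N2, N3, N4.
assert (B1 : 0 < al ^ 2 <= al / 1000) by nra.
assert (B2 : al ^ 3 <= al / 1000000) by (replace (al ^ 3) with (al * al ^ 2) by ring; nra).
assert (B3 : al ^ 4 <= al / 1000000) by (replace (al ^ 4) with (al ^ 2 * al ^ 2) by ring; nra).
assert (H1 := z_nonneg u ltac:(lra)). assert (H2 := geodesic_z2 _ _ _ _ (proj1 Hg) u).
assert (H3 := y_small u Hu). assert (H4 := E_gap u Hu). assert (H5 := E_T).
assert (H6 := geodesic_norm _ _ _ _ (proj1 Hg) u).
split; [ lra | ]. split; [ easy | ]. split; [ apply Rabs_le; lra | ]. split; [ apply Rabs_le; lra | ].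
split; [ apply Rabs_le; nra | ].
split; [ replace (4 * n * (1 + n) * t) with (4 * (1 + n) * (n * t)) by ring; apply Rabs_le; nra | ].
split; apply Rabs_le; [ unfold D; rewrite Px, Py; lra | rewrite PE; lra ].
Qed.

Lemma end_at_period_pos : 0 < end_at al x y z E (Lalpha al).
Proof.
assert (Hz0 : z 0 = 0) by apply Hg. assert (HE0 : E 0 = 0) by apply Hg.
destruct (geodesic_period _ _ _ _ (proj1 Hg) 0) as (Px & Py & Pz).
assert (PE := geodesic_E_period _ _ _ _ _ Hg 0). fold T in PE. rewrite Rminus_0_r in *.
unfold end_at. rewrite Px, Py, Pz, PE, Hz0, HE0. fold n. fold (D 0).
assert (H0 := D_0_pos). assert (H1 := E_T). assert (H2 := n_small). assert (H3 := nt_small (Lalpha al) ltac:(unfold T in *; lra)).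
unfold var_end, var_z, var_w. set (s := n * Lalpha al) in *. set (w := 4 * E T - 0).
assert (3 <= w) by (unfold w; lra).
replace (_ - - 0) with (D 0 * (2 * (1 + n) * w - s)) by ring.
apply Rmult_lt_0_compat; nra.
Qed.

End Estimates.

Definition end_deriv_at (al : R) (x y z E : R -> R) (t : R) : R :=
  let n1 := 4 * nome al * (1 + nome al) in
  var_end' (nome al) (nome al * t) n1 (n1 * t) (z t) (x t ^ 2 - y t ^ 2) (E t).

(** The last 9/10 of the period therefore lies within its last quarter. *)
Lemma Lalpha_gt_4 (al : R) : small_param al -> 4 < Lalpha al.
Proof.
intros H. apply Rle_lt_trans with (2 := Lalpha_lower al H).
assert (H1 := PI2_3_2). assert (H2 := sqrt_lt_R0 2 ltac:(lra)). assert (H3 := pow2_sqrt 2 ltac:(lra)).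
unfold PI2 in H1. assert (1.4 < sqrt 2) by nra. nra.
Qed.

(** The limits hold up to an error of 1. When more than 9/10 is left in the last quarter,
    [z >= 0.65] gives [8 - 16 z <= - 2.4]; when less is left, [z^2 <= 0.81] gives
    [64 (1 - z^2) > 12]. *)
Lemma end_at_sign : exists a0, 0 < a0 <= 1 / 1000 /\
  forall al x y z E, geodesic_E al x y z E -> al <= a0 ->
  (forall t, 0 < t <= Lalpha al - 9 / 10 -> end_at al x y z E t < 0) /\
  (forall u, 0 <= u <= 9 / 10 -> 0 < end_deriv_at al x y z E (Lalpha al - u)) /\
  0 < end_at al x y z E (Lalpha al).
Proof.
destruct var_end_approx as [C1 HC1]. destruct var_end'_approx as [C2 HC2].
assert (HM1 := Rmax_l (Rabs C1) (Rabs C2)). assert (HM2 := Rmax_r (Rabs C1) (Rabs C2)).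
set (M := Rmax (Rabs C1) (Rabs C2)) in *.
assert (HM0 : 0 <= M) by (apply Rle_trans with (Rabs C1); [ apply Rabs_pos | easy ]).
(* Chosen so that both [al <= 1 / 1000] and [M al <= 1]. *)
exists (/ (1000 + M)). split.
{ split; [ apply Rinv_0_lt_compat; lra | ]. unfold Rdiv. rewrite Rmult_1_l. apply Rinv_le_contravar; lra. }
intros al x y z E Hg Ha. assert (Hs := proj1 (proj1 Hg)). assert (Hs' := Hs). apply small_param_sq in Hs'.
assert (HL := Lalpha_gt_4 al Hs). assert (Hal : 0 < al <= 1 / 1000).
{ split; [ easy | ]. apply Rle_trans with (1 := Ha). unfold Rdiv. rewrite Rmult_1_l. apply Rinv_le_contravar; lra. }
assert (HMal : M * al <= 1).
{ apply Rmult_le_compat_l with (r := 1000 + M) in Ha; [ | lra ]. rewrite Rinv_r in Ha by lra. lra. }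
assert (HC : forall C, Rabs C <= M -> C * al <= 1) by (intros C H; generalize (RRle_abs C); nra).
split; [ | split; [ | now apply end_at_period_pos ] ].
- intros t Ht. destruct (Rle_dec t (2 * (Lalpha al / 4))) as [H1|H1]; [ now apply end_at_neg_half | ].
  destruct (Rle_dec t (3 * (Lalpha al / 4))) as [H2|H2]; [ apply end_at_neg_third_quarter; try easy; lra | ].
  set (u := Lalpha al - t). assert (Hu : 0 <= u <= Lalpha al / 4) by (unfold u; lra).
  destruct (last_quarter_args al x y z E Hg Hal u Hu) as (A1 & A2 & A3 & A4 & A5 & A6 & A7 & A8).
  replace (Lalpha al - u) with t in * by (unfold u; ring).
  assert (H := HC1 al (z u) _ _ _ _ ltac:(lra) A1 A4 A3 A7 A8).
  assert (K := HC C1 HM1). unfold end_at. rewrite A2.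
  assert (Hz : 0.65 <= z u).
  { apply Rle_trans with (z (9 / 10)).
    - assert (HZ := z_lower al x y z E Hg Hal (9 / 10) ltac:(lra)). nra.
    - apply (deriv_ge0_incr z (fun t => x t ^ 2 - y t ^ 2)); [ unfold u; lra | | ].
      + intros s _. apply Hg.
      + intros s Hs1. apply (D_pos al x y z E Hg). lra. }
  assert (H3 := Rle_trans _ _ _ (RRle_abs _) H). lra.
- intros u Hu. assert (Hu4 : 0 <= u <= Lalpha al / 4) by lra.
  destruct (last_quarter_args al x y z E Hg Hal u Hu4) as (A1 & A2 & A3 & A4 & A5 & A6 & A7 & A8).
  assert (H := HC2 al (z u) _ _ _ _ _ _ ltac:(lra) A1 A4 A3 A5 A6 A7 A8).
  assert (K := HC C2 HM2). unfold end_deriv_at. cbv zeta. rewrite A2.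
  assert (Hz := z_le_id al x y z E Hg u ltac:(lra)).
  assert (z u * z u <= 0.81) by nra.
  rewrite Rabs_minus_sym in H. assert (H3 := Rle_trans _ _ _ (RRle_abs _) H). lra.
Qed.

(** * Differentiability in the parameter *)

(** From [(x0 + y0)^2 = 1 + 2 al^2] and [(x0 - y0)^2 = 1 - 2 al^2]. *)
Definition init_x (al : R) : R := (sqrt (1 + 2 * al ^ 2) + sqrt (1 - 2 * al ^ 2)) / 2.
Definition init_y (al : R) : R := (sqrt (1 + 2 * al ^ 2) - sqrt (1 - 2 * al ^ 2)) / 2.

Lemma geodesic_init (al : R) (x y z : R -> R) : geodesic al x y z -> x 0 = init_x al /\ y 0 = init_y al.
Proof.
intros (_ & _ & _ & H1 & H2 & H3 & H4). unfold init_x, init_y.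
replace (1 + 2 * al ^ 2) with ((x 0 + y 0) ^ 2) by lra.
replace (1 - 2 * al ^ 2) with ((x 0 - y 0) ^ 2) by lra.
rewrite !sqrt_pow2 by lra. split; field.
Qed.

Section Variation.
Context (al : R) (x y z E : R -> R) (Hg : geodesic_E al x y z E).
Let n := nome al.
Let v t := var_w n (n * t) (z t) (x t ^ 2 - y t ^ 2) (E t).
Let w t := var_z n (n * t) (z t) (x t ^ 2 - y t ^ 2) (E t).

Let al_small : 0 < al /\ 2 * al ^ 2 < 1.
Proof. apply small_param_sq. apply Hg. Qed.

Let n_eq : n * (1 - 4 * al ^ 4) = 4 * al ^ 4.
Proof. unfold n, nome. field. replace (al ^ 4) with (al ^ 2 * al ^ 2) by ring. nra. Qed.

Lemma derive_v (t : R) : is_derive v t (w t).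
Proof.
assert (H1 := derive_z al x y z E Hg t). assert (H2 := derive_D al x y z E Hg t). assert (H3 := derive_E al x y z E Hg t). cbv beta in H2.
unfold v, w, var_w, var_z. set (D := fun t => x t ^ 2 - y t ^ 2) in *. change (x t ^ 2 - y t ^ 2) with (D t) in *.
apply (is_derive_ext (fun t => (1 + n) * (z t * E t + D t) - n * t * z t)); [ easy | ].
auto_derive.
- repeat split; try easy; eexists; [ exact H1 | exact H3 | exact H2 | exact H1 ].
- derive_known. ring.
Qed.

Lemma derive_w (t : R) : is_derive w t (2 * x t * (x t * (1 - v t)) - 2 * y t * (y t * (1 + v t))).
Proof.
assert (H1 := derive_z al x y z E Hg t). assert (H2 := derive_D al x y z E Hg t). assert (H3 := derive_E al x y z E Hg t). cbv beta in H2.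
assert (Hn := geodesic_norm _ _ _ _ (proj1 Hg) t).
replace (2 * x t * (x t * (1 - v t)) - 2 * y t * (y t * (1 + v t))) with (2 * (x t ^ 2 - y t ^ 2) - 2 * v t * (1 - z t ^ 2))
  by (replace (1 - z t ^ 2) with (x t ^ 2 + y t ^ 2) by lra; ring).
unfold v, w, var_w, var_z. set (D := fun t => x t ^ 2 - y t ^ 2) in *. change (x t ^ 2 - y t ^ 2) with (D t) in *.
apply (is_derive_ext (fun t => (1 + n) * (D t * E t - z t * (1 - z t * z t)) - (n * z t + n * t * D t))); [ easy | ].
auto_derive.
- repeat split; try easy; eexists; [ exact H2 | exact H3 | exact H1 | exact H1 | exact H1 | exact H1 | exact H2 ].
- derive_known. ring.
Qed.

(** The linearized constraint [x^2 + y^2 + z^2 = 1]. It turns the derivative of [E - v z] into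
    [- 2 z w], the variation of [1 - z^2], so that [E - v z] is the variation of [E]. *)
Lemma energy_variation (t : R) : z t * w t - (x t ^ 2 - y t ^ 2) * v t = - (1 - z t ^ 2).
Proof.
assert (H := D_sq al x y z E Hg t). cbv beta in H. unfold v, w, var_w, var_z.
set (D := x t ^ 2 - y t ^ 2) in *.
transitivity (- (1 + n) * (D ^ 2 + (1 - z t ^ 2) * z t ^ 2) - n * z t ^ 2); [ ring | ].
rewrite H. transitivity (- (1 + n) * (1 - z t ^ 2) - n * z t ^ 2 + (4 * al ^ 4 * n + 4 * al ^ 4)); [ ring | lra ].
Qed.

(** What remains after subtracting the candidate derivative solves the linearized system with a
    forcing quadratic in the difference of the two solutions. [flow_dist] bounds the forcing by the
    initial distance, and [gronwall] the remainder by its initial value plus the square of the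
    forcing. *)
Lemma variation_bound (al' : R) (x' y' z' E' : R -> R) (T : R) : geodesic_E al' x' y' z' E' -> 0 <= T ->
  let h := al' - al in
  let d0 := (x' 0 - x 0 - h * (x 0 * (1 - v 0) / al)) ^ 2 + (y' 0 - y 0 - h * (y 0 * (1 + v 0) / al)) ^ 2 in
  let e0 := (x' 0 - x 0) ^ 2 + (y' 0 - y 0) ^ 2 in
  (x' T - x T - h * (x T * (1 - v T) / al)) ^ 2 + (y' T - y T - h * (y T * (1 + v T) / al)) ^ 2
  + (z' T - z T - h * (w T / al)) ^ 2 + (E' T - E T - h * ((E T - v T * z T) / al)) ^ 2
  <= exp (10 * T) * d0 + exp (10 * T) * exp (12 * T) * e0 ^ 2.
Proof.
intros Hg' HT h d0 e0. destruct al_small as [Ha1 Ha2].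
assert (Hz0 : z 0 = 0) by apply Hg. assert (Hz0' : z' 0 = 0) by apply Hg'.
assert (HE0 : E 0 = 0) by apply Hg. assert (HE0' : E' 0 = 0) by apply Hg'.
assert (Hf : flow x y z) by apply Hg. assert (Hf' : flow x' y' z') by apply Hg'.
assert (Hn := geodesic_norm _ _ _ _ (proj1 Hg)). assert (Hn' := geodesic_norm _ _ _ _ (proj1 Hg')).
assert (He0 : 0 <= e0) by (unfold e0; apply Rplus_le_le_0_compat; apply pow2_ge_0).
assert (Hdist : forall t, 0 <= t <= T -> dist2 (x t) (y t) (z t) (x' t) (y' t) (z' t) <= e0 * exp (6 * T)).
{ intros t Ht. apply Rle_trans with (1 := flow_dist _ _ _ _ _ _ Hf Hf' (Hn 0) (Hn' 0) t (proj1 Ht)).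
  unfold dist2. rewrite Hz0, Hz0'. replace (_ + _ + _) with e0 by (unfold e0; ring).
  apply Rmult_le_compat_l; [ easy | ]. destruct (Req_dec t T) as [->|Hne]; [ lra | left; apply exp_increasing; lra ]. }
set (K := (e0 * exp (6 * T)) ^ 2).
set (dx := fun t => x' t - x t - h * (x t * (1 - v t) / al)).
set (dy := fun t => y' t - y t - h * (y t * (1 + v t) / al)).
set (dz := fun t => z' t - z t - h * (w t / al)).
set (dE := fun t => E' t - E t - h * ((E t - v t * z t) / al)).
assert (Gx : forall t, is_derive dx t (- (z t * dx t + x t * dz t + (x' t - x t) * (z' t - z t)))).
{ intros t. assert (H1 := proj1 (Hf t)). assert (H2 := proj1 (Hf' t)). assert (H3 := derive_v t). unfold dx, dz. auto_derive.
  - repeat split; try easy; eexists; [ exact H2 | exact H1 | exact H1 | exact H3 ].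
  - derive_known. field. lra. }
assert (Gy : forall t, is_derive dy t (z t * dy t + y t * dz t + (y' t - y t) * (z' t - z t))).
{ intros t. assert (H1 := proj1 (proj2 (Hf t))). assert (H2 := proj1 (proj2 (Hf' t))). assert (H3 := derive_v t). unfold dy, dz. auto_derive.
  - repeat split; try easy; eexists; [ exact H2 | exact H1 | exact H1 | exact H3 ].
  - derive_known. field. lra. }
assert (Gz : forall t, is_derive dz t (2 * x t * dx t - 2 * y t * dy t + (x' t - x t) ^ 2 - (y' t - y t) ^ 2)).
{ intros t. assert (H1 := proj2 (proj2 (Hf t))). assert (H2 := proj2 (proj2 (Hf' t))). assert (H3 := derive_w t). unfold dx, dy, dz. auto_derive.
  - repeat split; try easy; eexists; [ exact H2 | exact H1 | exact H3 ].
  - derive_known. field. lra. }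
assert (GE : forall t, is_derive dE t (- (2 * z t * dz t + (z' t - z t) ^ 2))).
{ intros t. assert (H1 := proj2 (proj2 Hg) t). assert (H2 := proj2 (proj2 Hg') t). assert (H3 := derive_v t).
  assert (H4 := proj2 (proj2 (Hf t))). assert (H5 := energy_variation t). unfold dE, dz. auto_derive.
  - repeat split; try easy; eexists; [ exact H2 | exact H1 | exact H1 | exact H3 | exact H4 ].
  - derive_known.
    transitivity ((1 - z' t ^ 2) - (1 - z t ^ 2) - h * ((1 - z t ^ 2) - w t * z t - (x t ^ 2 - y t ^ 2) * v t) / al); [ field; lra | ].
    replace ((x t ^ 2 - y t ^ 2) * v t) with (z t * w t + (1 - z t ^ 2)) by lra. field. lra. }
set (N := fun t => dx t ^ 2 + dy t ^ 2 + dz t ^ 2 + dE t ^ 2).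
change (N T <= exp (10 * T) * d0 + exp (10 * T) * exp (12 * T) * e0 ^ 2).
assert (HK : 0 <= K) by apply pow2_ge_0.
assert (HN : N T <= (N 0 + 4 * K / 10) * exp (10 * T)).
{ apply (gronwall N (fun t => 2 * dx t * (- (z t * dx t + x t * dz t + (x' t - x t) * (z' t - z t)))
    + 2 * dy t * (z t * dy t + y t * dz t + (y' t - y t) * (z' t - z t))
    + 2 * dz t * (2 * x t * dx t - 2 * y t * dy t + (x' t - x t) ^ 2 - (y' t - y t) ^ 2)
    + 2 * dE t * (- (2 * z t * dz t + (z' t - z t) ^ 2))) 10 (4 * K) T); try lra.
  - intros t _. assert (H1 := Gx t). assert (H2 := Gy t). assert (H3 := Gz t). assert (H4 := GE t).
    unfold N. clearbody dx dy dz dE. auto_derive.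
    + repeat split; eexists; eassumption.
    + derive_known. ring.
  - intros t Ht. assert (H := Hdist t Ht).
    destruct (unit_vector_bounds _ _ _ (Hn t)) as (A1 & A2 & A3).
    unfold dist2 in H. set (p := x' t - x t) in *. set (q := y' t - y t) in *. set (r := z' t - z t) in *.
    assert (Hp := pow2_ge_0 p). assert (Hq := pow2_ge_0 q). assert (Hr := pow2_ge_0 r).
    (* The forcing terms of the four equations are [p r], [q r], [p^2 - q^2] and [r^2], up to sign;
       the square of each is at most [K]. *)
    assert (HK2 : (p ^ 2 + q ^ 2 + r ^ 2) ^ 2 <= K) by (unfold K; apply pow_incr; lra).
    assert (K1 : (p * r) ^ 2 <= K).
    { apply Rle_trans with (2 := HK2). replace ((p * r) ^ 2) with (p ^ 2 * r ^ 2) by ring. nra. }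
    assert (K2 : (q * r) ^ 2 <= K).
    { apply Rle_trans with (2 := HK2). replace ((q * r) ^ 2) with (q ^ 2 * r ^ 2) by ring. nra. }
    assert (K3 : (p ^ 2 - q ^ 2) ^ 2 <= K).
    { apply Rle_trans with (2 := HK2). nra. }
    assert (K4 : (r ^ 2) ^ 2 <= K).
    { apply Rle_trans with (2 := HK2). nra. }
    unfold N. set (a := dx t) in *. set (b := dy t) in *. set (c := dz t) in *. set (d := dE t) in *.
    assert (B1 := amgm_bound (-2 * z t) 2 a a ltac:(lra)).
    assert (B2 := amgm_bound (2 * x t) 2 a c ltac:(lra)).
    assert (B3 := amgm_bound (-2) 2 a (p * r) ltac:(lra)).
    assert (B4 := amgm_bound (2 * z t) 2 b b ltac:(lra)).
    assert (B5 := amgm_bound (-2 * y t) 2 b c ltac:(lra)).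
    assert (B6 := amgm_bound 2 2 b (q * r) ltac:(lra)).
    assert (B7 := amgm_bound 2 2 c (p ^ 2 - q ^ 2) ltac:(lra)).
    assert (B8 := amgm_bound (-4 * z t) 4 d c ltac:(lra)).
    assert (B9 := amgm_bound (-2) 2 d (r ^ 2) ltac:(lra)).
    generalize (pow2_ge_0 a) (pow2_ge_0 b) (pow2_ge_0 c) (pow2_ge_0 d). intros.
    apply Rle_trans with ((-2 * z t) * (a * a) + (2 * x t) * (a * c) + -2 * (a * (p * r)) + (2 * z t) * (b * b) + (-2 * y t) * (b * c)
      + 2 * (b * (q * r)) + 2 * (c * (p ^ 2 - q ^ 2)) + (-4 * z t) * (d * c) + -2 * (d * r ^ 2)); [ right; ring | lra ]. }
apply Rle_trans with (1 := HN).
assert (N0 : N 0 = d0).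
{ unfold N, dx, dy, dz, dE, d0. replace (w 0) with 0 by (unfold w, var_z; rewrite Hz0, HE0; ring).
  rewrite Hz0, Hz0', HE0, HE0'. field. lra. }
rewrite N0. replace (exp (12 * T)) with (exp (6 * T) ^ 2).
2:{ simpl. rewrite Rmult_1_r, <- exp_plus. f_equal. ring. }
unfold K. generalize (exp_pos (10 * T)) (pow2_ge_0 (e0 * exp (6 * T))). intros.
replace (exp (10 * T) * exp (6 * T) ^ 2 * e0 ^ 2) with (exp (10 * T) * (e0 * exp (6 * T)) ^ 2) by ring. nra.
Qed.

(** Shows that the candidate derivative is right at time 0, where [v] equals [1 / D(0)] and [D(0)]
    is the product of the two square roots. *)
Lemma init_derive :
  is_derive init_x al (x 0 * (1 - v 0) / al) /\ is_derive init_y al (y 0 * (1 + v 0) / al).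
Proof.
destruct al_small as [Ha1 Ha2]. destruct (geodesic_init _ _ _ _ (proj1 Hg)) as [Hx Hy].
assert (Hp : 0 < 1 + 2 * al ^ 2) by nra. assert (Hm : 0 < 1 - 2 * al ^ 2) by lra.
assert (HS := sqrt_lt_R0 _ Hp). assert (HM := sqrt_lt_R0 _ Hm).
assert (HS2 := pow2_sqrt _ (Rlt_le _ _ Hp)). assert (HM2 := pow2_sqrt _ (Rlt_le _ _ Hm)).
assert (Hv : v 0 = / (sqrt (1 + 2 * al ^ 2) * sqrt (1 - 2 * al ^ 2))).
{ unfold v, var_w. assert (Hz0 : z 0 = 0) by apply Hg. assert (HE0 : E 0 = 0) by apply Hg.
  rewrite Hz0, HE0, Hx, Hy. unfold init_x, init_y, n, nome. set (S := sqrt (1 + 2 * al ^ 2)) in *. set (M := sqrt (1 - 2 * al ^ 2)) in *.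
  replace (4 * al ^ 4) with (1 - S ^ 2 * M ^ 2) by (rewrite HS2, HM2; ring). field. split; nra. }
rewrite Hv, Hx, Hy. unfold init_x, init_y.
assert (DS : is_derive (fun u => sqrt (1 + 2 * u ^ 2)) al (4 * al * / (2 * sqrt (1 + 2 * al ^ 2)))).
{ apply (is_derive_comp sqrt (fun u => 1 + 2 * u ^ 2)); [ now apply is_derive_Reals, derivable_pt_lim_sqrt | auto_derive; [ easy | ring ] ]. }
assert (DM : is_derive (fun u => sqrt (1 - 2 * u ^ 2)) al (- 4 * al * / (2 * sqrt (1 - 2 * al ^ 2)))).
{ apply (is_derive_comp sqrt (fun u => 1 - 2 * u ^ 2)); [ now apply is_derive_Reals, derivable_pt_lim_sqrt | auto_derive; [ easy | ring ] ]. }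
set (S := sqrt (1 + 2 * al ^ 2)) in *. set (M := sqrt (1 - 2 * al ^ 2)) in *.
split.
- replace ((S + M) / 2 * (1 - / (S * M)) / al) with (/ 2 * (4 * al * / (2 * S) + - 4 * al * / (2 * M))).
  + apply (is_derive_ext (fun u => / 2 * (sqrt (1 + 2 * u ^ 2) + sqrt (1 - 2 * u ^ 2)))); [ intros; eq_R; field | ].
    apply is_derive_scal. now apply (is_derive_plus (V := R_NormedModule)).
  + transitivity ((2 * al ^ 2 * M - 2 * al ^ 2 * S) / (2 * al * (S * M))); [ field; lra | ].
    replace (2 * al ^ 2 * M - 2 * al ^ 2 * S) with ((S ^ 2 - 1) * M + (M ^ 2 - 1) * S) by (rewrite HS2, HM2; ring). field. lra.
- replace ((S - M) / 2 * (1 + / (S * M)) / al) with (/ 2 * (4 * al * / (2 * S) - - 4 * al * / (2 * M))).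
  + apply (is_derive_ext (fun u => / 2 * (sqrt (1 + 2 * u ^ 2) - sqrt (1 - 2 * u ^ 2)))); [ intros; eq_R; field | ].
    apply is_derive_scal. now apply (is_derive_minus (V := R_NormedModule)).
  + transitivity ((2 * al ^ 2 * M + 2 * al ^ 2 * S) / (2 * al * (S * M))); [ field; lra | ].
    replace (2 * al ^ 2 * M + 2 * al ^ 2 * S) with ((S ^ 2 - 1) * M - (M ^ 2 - 1) * S) by (rewrite HS2, HM2; ring). field. lra.
Qed.
End Variation.

(** With [h = u - a], the first bracket is [o(h^2)] because [p] and [q] are differentiable, and the
    second is [O(h^4)]; so the remainder of [f] is [o(h)]. *)
Lemma is_derive_from_square_bound (f p q : R -> R) (a l lp lq A B : R) :
  0 <= A -> 0 <= B -> is_derive p a lp -> is_derive q a lq ->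
  locally a (fun u => (f u - f a - (u - a) * l) ^ 2 <=
    A * ((p u - p a - (u - a) * lp) ^ 2 + (q u - q a - (u - a) * lq) ^ 2) +
    B * ((p u - p a) ^ 2 + (q u - q a) ^ 2) ^ 2) ->
  is_derive f a l.
Proof.
intros HA HB Hp Hq [d Hd].
apply is_derive_Reals in Hp, Hq. apply is_derive_Reals. intros eps Heps.
(* [e1] and [h0] make [A e1^2] and [B K h^2] at most [eps^2 / 16], and [2/16 + 1/16 <= 1/4]. The cap
   1 on [e1] gives the Lipschitz constants [Rabs lp + 1] and [Rabs lq + 1] used in [K]. *)
set (e1 := Rmin 1 (eps / (4 * (A + 1)))).
assert (He0 : 0 < eps / (4 * (A + 1))) by (apply Rdiv_lt_0_compat; lra).
assert (He1 : 0 < e1) by (apply Rmin_glb_lt; lra).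
assert (He1' : e1 <= 1) by apply Rmin_l. assert (He1'' : e1 <= eps / (4 * (A + 1))) by apply Rmin_r.
set (K := ((Rabs lp + 1) ^ 2 + (Rabs lq + 1) ^ 2) ^ 2).
assert (HK : 0 <= K) by apply pow2_ge_0. assert (HBK : 0 <= B * K) by now apply Rmult_le_pos.
set (h0 := eps / (4 * (B * K + 1))). assert (Hh0 : 0 < h0) by (apply Rdiv_lt_0_compat; lra).
destruct (Hp e1 He1) as [d1 H1]. destruct (Hq e1 He1) as [d2 H2].
assert (Hmin : 0 < Rmin d (Rmin h0 (Rmin d1 d2))).
{ repeat apply Rmin_glb_lt; try easy; apply cond_pos. }
exists (mkposreal _ Hmin). intros h Hh0' Hh. simpl in Hh.
assert (Hhd : Rabs h < d) by (apply Rlt_le_trans with (1 := Hh), Rmin_l).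
assert (Hh2 : Rabs h < Rmin h0 (Rmin d1 d2)) by (apply Rlt_le_trans with (1 := Hh), Rmin_r).
assert (Hhh : Rabs h < h0) by (apply Rlt_le_trans with (1 := Hh2), Rmin_l).
assert (Hh3 : Rabs h < Rmin d1 d2) by (apply Rlt_le_trans with (1 := Hh2), Rmin_r).
assert (Hh4 : Rabs h < d1) by (apply Rlt_le_trans with (1 := Hh3), Rmin_l).
assert (Hh5 : Rabs h < d2) by (apply Rlt_le_trans with (1 := Hh3), Rmin_r).
assert (Habs : 0 < Rabs h) by now apply Rabs_pos_lt.
assert (Hsq : Rabs h ^ 2 = h ^ 2) by apply pow2_abs.
assert (Hdiff : forall g k, Rabs ((g (a + h) - g a) / h - k) < e1 -> Rabs (g (a + h) - g a - h * k) <= e1 * Rabs h).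
{ intros g k Hgk. replace (g (a + h) - g a - h * k) with (((g (a + h) - g a) / h - k) * h) by (field; easy).
  rewrite Rabs_mult. apply Rmult_le_compat_r; lra. }
assert (Hlip : forall g k, Rabs (g (a + h) - g a - h * k) <= e1 * Rabs h -> (g (a + h) - g a) ^ 2 <= (Rabs k + 1) ^ 2 * h ^ 2).
{ intros g k Hgk. rewrite <- Hsq, <- Rpow_mult_distr. rewrite <- (pow2_abs (g (a + h) - g a)). apply pow_incr. split; [ apply Rabs_pos | ].
  replace (g (a + h) - g a) with ((g (a + h) - g a - h * k) + h * k) by ring.
  generalize (Rabs_triang (g (a + h) - g a - h * k) (h * k)). rewrite Rabs_mult. generalize (Rabs_pos k). nra. }
assert (Hsqd : forall g k, Rabs (g (a + h) - g a - h * k) <= e1 * Rabs h -> (g (a + h) - g a - h * k) ^ 2 <= e1 ^ 2 * h ^ 2).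
{ intros g k Hgk. rewrite <- Hsq, <- Rpow_mult_distr. rewrite <- (pow2_abs (_ - _)). apply pow_incr. split; [ apply Rabs_pos | easy ]. }
assert (P1 := Hdiff p lp (H1 h Hh0' Hh4)). assert (Q1 := Hdiff q lq (H2 h Hh0' Hh5)).
assert (P2 := Hlip p lp P1). assert (Q2 := Hlip q lq Q1). assert (P3 := Hsqd p lp P1). assert (Q3 := Hsqd q lq Q1).
assert (Hf : (f (a + h) - f a - h * l) ^ 2 <= (eps / 2 * Rabs h) ^ 2).
{ assert (H := Hd (a + h)). replace (a + h - a) with h in H by ring.
  assert (Hb : ball a d (a + h)).
  { change (Rabs (a + h - a) < d). now replace (a + h - a) with h by ring. }
  apply Rle_trans with (1 := H Hb).
  assert (R1 : ((p (a + h) - p a) ^ 2 + (q (a + h) - q a) ^ 2) ^ 2 <= K * (h ^ 2 * h ^ 2)).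
  { unfold K. replace (((Rabs lp + 1) ^ 2 + (Rabs lq + 1) ^ 2) ^ 2 * (h ^ 2 * h ^ 2)) with ((((Rabs lp + 1) ^ 2 + (Rabs lq + 1) ^ 2) * h ^ 2) ^ 2) by ring.
    apply pow_incr. split; [ generalize (pow2_ge_0 (p (a + h) - p a)) (pow2_ge_0 (q (a + h) - q a)); lra | lra ]. }
  assert (R2 : A * e1 ^ 2 <= eps ^ 2 / 16).
  { apply Rle_trans with (A * (eps / (4 * (A + 1))) ^ 2).
    - apply Rmult_le_compat_l; [ easy | apply pow_incr; lra ].
    - replace (A * (eps / (4 * (A + 1))) ^ 2) with (eps ^ 2 / 16 * (A / (A + 1) ^ 2)) by (field; lra).
      rewrite <- (Rmult_1_r (eps ^ 2 / 16)) at 2. apply Rmult_le_compat_l; [ nra | ].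
      apply Rmult_le_reg_r with ((A + 1) ^ 2); [ nra | ]. field_simplify; nra. }
  assert (R3 : B * K * h ^ 2 <= eps ^ 2 / 16).
  { apply Rle_trans with (B * K * h0 ^ 2).
    - apply Rmult_le_compat_l; [ easy | rewrite <- Hsq; apply pow_incr; lra ].
    - unfold h0. set (k := B * K) in *. replace (k * (eps / (4 * (k + 1))) ^ 2) with (eps ^ 2 / 16 * (k / (k + 1) ^ 2)) by (field; lra).
      rewrite <- (Rmult_1_r (eps ^ 2 / 16)) at 2. apply Rmult_le_compat_l; [ nra | ].
      apply Rmult_le_reg_r with ((k + 1) ^ 2); [ nra | ]. field_simplify; nra. }
  rewrite Rpow_mult_distr, Hsq. assert (Hh2' := pow2_ge_0 h).
  apply Rle_trans with (A * (e1 ^ 2 * h ^ 2 + e1 ^ 2 * h ^ 2) + B * (K * (h ^ 2 * h ^ 2))).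
  - apply Rplus_le_compat; apply Rmult_le_compat_l; lra.
  - replace (A * (e1 ^ 2 * h ^ 2 + e1 ^ 2 * h ^ 2) + B * (K * (h ^ 2 * h ^ 2))) with ((2 * (A * e1 ^ 2) + B * K * h ^ 2) * h ^ 2) by ring.
    apply Rmult_le_compat_r; [ easy | ]. assert (0 <= eps ^ 2) by apply pow2_ge_0. lra. }
assert (Hf2 : Rabs (f (a + h) - f a - h * l) <= eps / 2 * Rabs h).
{ apply Rsqr_incr_0_var; [ | nra ]. rewrite <- Rsqr_abs. unfold Rsqr. simpl in Hf. lra. }
replace ((f (a + h) - f a) / h - l) with ((f (a + h) - f a - h * l) / h) by (field; easy).
unfold Rdiv. rewrite Rabs_mult, Rabs_inv.
apply Rmult_lt_reg_r with (Rabs h); [ easy | ]. rewrite Rmult_assoc, Rinv_l by lra. nra.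
Qed.

Lemma locally_small_param (al : R) : small_param al -> locally al small_param.
Proof.
intros [H1 H2]. apply (locally_interval small_param al 0 (1 / sqrt 2)); [ easy | easy | ].
intros u Hu1 Hu2. now split.
Qed.

Lemma geodesic_variation (X Y Z E : R -> R -> R) (al t : R) :
  (forall be, small_param be -> geodesic_E be (X be) (Y be) (Z be) (E be)) ->
  small_param al -> 0 <= t ->
  let n := nome al in
  let D := X al t ^ 2 - Y al t ^ 2 in
  let v := var_w n (n * t) (Z al t) D (E al t) in
  let w := var_z n (n * t) (Z al t) D (E al t) in
  is_derive (fun be => X be t) al (X al t * (1 - v) / al) /\
  is_derive (fun be => Y be t) al (Y al t * (1 + v) / al) /\
  is_derive (fun be => Z be t) al (w / al) /\
  is_derive (fun be => E be t) al ((E al t - v * Z al t) / al).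
Proof.
intros HG Hal Ht n D v w.
assert (Hg := HG al Hal). destruct (init_derive _ _ _ _ _ Hg) as [Ix Iy].
destruct (geodesic_init _ _ _ _ (proj1 Hg)) as [Gx Gy].
assert (Hb : locally al (fun u =>
  let h := u - al in
  (X u t - X al t - h * (X al t * (1 - v) / al)) ^ 2 + (Y u t - Y al t - h * (Y al t * (1 + v) / al)) ^ 2
  + (Z u t - Z al t - h * (w / al)) ^ 2 + (E u t - E al t - h * ((E al t - v * Z al t) / al)) ^ 2
  <= exp (10 * t) * ((init_x u - init_x al - h * (X al 0 * (1 - var_w n (n * 0) (Z al 0) (X al 0 ^ 2 - Y al 0 ^ 2) (E al 0)) / al)) ^ 2
     + (init_y u - init_y al - h * (Y al 0 * (1 + var_w n (n * 0) (Z al 0) (X al 0 ^ 2 - Y al 0 ^ 2) (E al 0)) / al)) ^ 2)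
  + exp (10 * t) * exp (12 * t) * ((init_x u - init_x al) ^ 2 + (init_y u - init_y al) ^ 2) ^ 2)).
{ generalize (locally_small_param al Hal). apply filter_imp. intros u Hu h.
  destruct (geodesic_init _ _ _ _ (proj1 (HG u Hu))) as [Gx' Gy']. rewrite <- Gx, <- Gy, <- Gx', <- Gy'.
  exact (variation_bound _ _ _ _ _ Hg u _ _ _ _ t (HG u Hu) Ht). }
assert (HE1 := exp_pos (10 * t)). assert (HE2 := exp_pos (12 * t)).
assert (HE3 : 0 <= exp (10 * t) * exp (12 * t)) by nra.
repeat match goal with |- _ /\ _ => split end;
  (eapply is_derive_from_square_bound; [ | | exact Ix | exact Iy | ]; [ exact (Rlt_le _ _ HE1) | exact HE3 | ];
   revert Hb; apply filter_imp; cbv zeta; intros u Hu; apply Rle_trans with (2 := Hu);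
   match goal with |- _ <= ?a ^ 2 + ?b ^ 2 + ?c ^ 2 + ?d ^ 2 =>
     generalize (pow2_ge_0 a) (pow2_ge_0 b) (pow2_ge_0 c) (pow2_ge_0 d); lra end).
Qed.

(** * The parameter as a function of the period *)

Lemma geodesic_x0 (al : R) (x y z : R -> R) : geodesic al x y z -> 1 - al ^ 2 <= x 0 ^ 2 <= 1 /\ 1 - al ^ 2 <= x 0 <= 1.
Proof.
intros (H & _ & _ & H1 & H2 & H3 & H4). apply small_param_sq in H.
assert (y 0 ^ 2 <= al ^ 2) by nra. assert (x 0 <= 1) by nra.
repeat split; nra.
Qed.

(** As [z <= 1], [y] grows at most like [e^t], from [al^2 / x(0)] at time 0 to [al] at the quarter
    period. This is the source of the exponential rate in the bound on [b]. *)
Lemma geodesic_param_lower (al : R) (x y z : R -> R) : geodesic al x y z ->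
  x 0 ^ 2 <= al ^ 2 * exp (Lalpha al / 2).
Proof.
intros H. set (T := Lalpha al / 4).
destruct (geodesic_quarter _ _ _ _ H) as (HT & Hxy & _). fold T in HT, Hxy.
assert (Hpos := geodesic_pos _ _ _ _ H). assert (Hp := geodesic_prod _ _ _ _ H). assert (Hz := geodesic_z2 _ _ _ _ H).
destruct H as (Hs & Hf & _). apply small_param_sq in Hs.
assert (HyT : y T = al). { specialize (Hp T). rewrite Hxy in Hp. generalize (Hpos T). nra. }
assert (Hd : y T * exp (- T) <= y 0 * exp (- 0)).
{ apply (deriv_le0_decr (fun t => y t * exp (- t)) (fun t => y t * (z t - 1) * exp (- t))); [ lra | | ].
  - intros s _. assert (H2 := proj1 (proj2 (Hf s))). auto_derive; [ eexists; exact H2 | ]. derive_known. ring.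
  - intros s _. generalize (Hpos s) (Hz s) (exp_pos (- s)). intros. assert (y s * (z s - 1) <= 0) by nra. nra. }
rewrite HyT, Ropp_0, exp_0, exp_Ropp in Hd.
assert (HeT := exp_pos T).
apply Rmult_le_compat_r with (r := exp T) in Hd; [ | lra ]. rewrite Rmult_assoc, Rinv_l in Hd by lra.
assert (Hx : x 0 <= al * exp T).
{ generalize (Hp 0) (Hpos 0). intros Hp0 [A B].
  apply Rmult_le_compat_l with (r := x 0) in Hd; [ | lra ].
  replace (x 0 * (y 0 * 1 * exp T)) with (al * (al * exp T)) in Hd by (transitivity (x 0 * y 0 * exp T); [ rewrite Hp0; ring | ring ]).
  apply Rmult_le_reg_l with al; lra. }
replace (exp (Lalpha al / 2)) with (exp T ^ 2).
- rewrite <- Rpow_mult_distr. apply pow_incr. generalize (Hpos 0). lra.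
- simpl. rewrite Rmult_1_r, <- exp_plus. f_equal. unfold T. field.
Qed.

Lemma Lalpha_decr (a b : R) : 0 < a -> a < b -> Lalpha b < Lalpha a.
Proof.
intros Ha Hab. apply (deriv_lt0_decr Lalpha (Derive Lalpha)); [ easy | | ].
- intros t Ht. destruct (Lalpha_derive t ltac:(lra)) as (l & _ & Hl). now rewrite (is_derive_unique _ _ _ Hl).
- intros t Ht. destruct (Lalpha_derive t ltac:(lra)) as (l & Hn & Hl). now rewrite (is_derive_unique _ _ _ Hl).
Qed.

Lemma Lalpha_inj (a b : R) : 0 < a -> 0 < b -> Lalpha a = Lalpha b -> a = b.
Proof.
intros Ha Hb H. destruct (Rtotal_order a b) as [Hl|[Hl|Hl]]; [ | easy | ].
- generalize (Lalpha_decr a b Ha Hl). lra.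
- generalize (Lalpha_decr b a Hb Hl). lra.
Qed.

(** [inv] is known only as a right inverse. Monotonicity of [Lalpha] traps its values between
    [al - d] and [al + d], which gives continuity; then the difference quotient is the reciprocal of
    that of [Lalpha]. *)
Lemma Lalpha_inverse_derive (inv : R -> R) :
  (forall L, PI * sqrt 2 < L -> small_param (inv L) /\ Lalpha (inv L) = L) ->
  forall L, PI * sqrt 2 < L -> exists l, l < 0 /\ is_derive inv L l.
Proof.
intros Hinv L HL. destruct (Hinv L HL) as [Hs HLa]. set (al := inv L) in *.
assert (Ha : 0 < al) by apply Hs.
destruct (Lalpha_derive al Ha) as (g & Hg & Hd).
exists (/ g). split; [ now apply Rinv_lt_0_compat | ].
apply is_derive_Reals in Hd. apply is_derive_Reals. intros eps Heps.
assert (Hc : continuous Rinv g) by (apply (ex_derive_continuous (V := R_NormedModule)); auto_derive; lra).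
destruct (proj1 (filterlim_locally (F := locally g) Rinv (/ g)) Hc (mkposreal eps Heps)) as [e1 He1].
destruct (Hd e1 (cond_pos e1)) as [d1 Hd1].
set (d := Rmin d1 al / 2).
assert (Hd0 : 0 < d /\ d < d1 /\ d < al).
{ assert (0 < Rmin d1 al) by (apply Rmin_glb_lt; [ apply cond_pos | easy ]).
  generalize (Rmin_l d1 al) (Rmin_r d1 al). unfold d. lra. }
assert (M1 := Lalpha_decr al (al + d) Ha ltac:(lra)). assert (M2 := Lalpha_decr (al - d) al ltac:(lra) ltac:(lra)).
rewrite HLa in M1, M2.
assert (Hm : 0 < Rmin (L - PI * sqrt 2) (Rmin (L - Lalpha (al + d)) (Lalpha (al - d) - L))) by (repeat apply Rmin_glb_lt; lra).
exists (mkposreal _ Hm). intros k Hk0 Hk. simpl in Hk.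
assert (K1 := Rlt_le_trans _ _ _ Hk (Rmin_l _ _)). assert (K2 := Rlt_le_trans _ _ _ Hk (Rmin_r _ _)).
assert (K3 := Rlt_le_trans _ _ _ K2 (Rmin_l _ _)). assert (K4 := Rlt_le_trans _ _ _ K2 (Rmin_r _ _)).
apply Rabs_def2 in K1, K3, K4.
destruct (Hinv (L + k) ltac:(lra)) as [Hs' HLa']. fold al. set (h := inv (L + k) - al).
assert (Hh : Rabs h < d1).
{ assert (inv (L + k) < al + d).
  { apply Rnot_le_lt. intros [Hc'|Hc']; [ generalize (Lalpha_decr (al + d) _ ltac:(lra) Hc'); lra | rewrite <- Hc' in HLa'; lra ]. }
  assert (al - d < inv (L + k)).
  { apply Rnot_le_lt. intros [Hc'|Hc']; [ generalize (Lalpha_decr _ (al - d) (proj1 Hs') Hc'); lra | rewrite Hc' in HLa'; lra ]. }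
  apply Rabs_def1; unfold h; lra. }
assert (Hh0 : h <> 0).
{ intros H0. apply Hk0. replace (inv (L + k)) with al in HLa' by (unfold h in H0; lra). lra. }
assert (HQ := Hd1 h Hh0 Hh). replace (al + h) with (inv (L + k)) in HQ by (unfold h; ring).
rewrite HLa, HLa' in HQ. replace (L + k - L) with k in HQ by ring.
assert (HB := He1 (k / h)). replace (h / k) with (/ (k / h)) by (field; easy). apply HB. exact HQ.
Qed.

(** Multiplying by the integrating factors gives [(a x)' = 2 x^2] and [(b y)' = 2 y^2]. Hence
    [a x - z] is a primitive of [1 - z^2], and [b y] equals [E - z]. *)
Lemma system_geodesic (al : R) (x y z a b : R -> R) : small_param al ->
  is_system_solution (Lalpha al) x y z a b ->
  let E t := a t * x t - z t in
  geodesic_E al x y z E /\ forall t, a t = (E t + z t) / x t /\ b t = (E t - z t) / y t.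
Proof.
intros Hs (al' & x0 & y0 & Ha & HL & Hxy & Hy & Hn & Hp & Hx0 & Hy0 & Hz0 & Ha0 & Hb0 & Hd) E.
(* The solution predicate hides its own parameter; injectivity of the period identifies it with
   [al]. *)
assert (al' = al) by (apply Lalpha_inj; [ apply Ha | apply Hs | easy ]). subst al'.
subst x0 y0.
assert (HG : geodesic al x y z).
{ repeat split; try easy; try apply Hs; apply Hd. }
assert (HE : forall t, is_derive E t (1 - z t ^ 2)).
{ intros t. destruct (Hd t) as (H1 & H2 & H3 & H4 & H5). unfold E. auto_derive.
  - repeat split; try easy; eexists; eassumption.
  - derive_known. generalize (geodesic_norm _ _ _ _ HG t). nra. }
assert (HE0 : E 0 = 0) by (unfold E; rewrite Ha0, Hz0; ring).
split; [ easy | ]. intros t. destruct (geodesic_pos _ _ _ _ HG t) as [Px Py].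
split; [ unfold E; field; lra | ].
assert (H0 : b t * y t - E t + z t = b 0 * y 0 - E 0 + z 0).
{ apply (deriv_zero_const (fun t => b t * y t - E t + z t)). intros s.
  destruct (Hd s) as (H1 & H2 & H3 & H4 & H5). assert (H6 := HE s). clearbody E. auto_derive.
  - repeat split; try easy; eexists; eassumption.
  - derive_known. generalize (geodesic_norm _ _ _ _ HG s). nra. }
rewrite Hb0, HE0, Hz0 in H0. apply Rmult_eq_reg_r with (y t); [ | lra ]. field_simplify; lra.
Qed.

Section Family.
Context (X Y Z E : R -> R -> R)
  (HG : forall be, small_param be -> geodesic_E be (X be) (Y be) (Z be) (E be)) (r : R) (Hr : 0 <= r).
Let G be := end_at be (X be) (Y be) (Z be) (E be) r.

Lemma endpoint_derive (al : R) : small_param al ->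
  is_derive (fun be => (E be r + Z be r) / X be r) al (G al / (al * X al r)) /\
  is_derive (fun be => (E be r - Z be r) / Y be r) al (- G al / (al * Y al r)).
Proof.
intros Hs. destruct (geodesic_variation X Y Z E al r HG Hs Hr) as (H1 & H2 & H3 & H4).
destruct (geodesic_pos _ _ _ _ (proj1 (HG al Hs)) r) as [Px Py]. assert (Ha : 0 < al) by apply Hs.
unfold G, end_at, var_end. set (v := var_w _ _ _ _ _) in *. set (w := var_z _ _ _ _ _) in *. clearbody v w. split.
- auto_derive.
  + repeat split; try lra; eexists; eassumption.
  + derive_known. field. lra.
- auto_derive.
  + repeat split; try lra; eexists; eassumption.
  + derive_known. field. lra.
Qed.

Lemma end_at_derive (al : R) : small_param al ->
  is_derive G al (end_deriv_at al (X al) (Y al) (Z al) (E al) r / al).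
Proof.
intros Hs. destruct (geodesic_variation X Y Z E al r HG Hs Hr) as (H1 & H2 & H3 & H4).
assert (Hn := geodesic_norm _ _ _ _ (proj1 (HG al Hs)) r). assert (Ha : 0 < al) by apply Hs.
assert (Hs' := Hs). apply small_param_sq in Hs'.
assert (Hnome : is_derive nome al (4 * nome al * (1 + nome al) / al)).
{ assert (0 < 1 - 4 * al ^ 4) by (replace (al ^ 4) with (al ^ 2 * al ^ 2) by ring; nra).
  unfold nome. auto_derive; [ lra | field; lra ]. }
set (D := fun be => X be r ^ 2 - Y be r ^ 2).
unfold G, end_at, end_deriv_at, var_end, var_end'. cbv zeta. change (X al r ^ 2 - Y al r ^ 2) with (D al) in *.
set (v := var_w (nome al) (nome al * r) (Z al r) (D al) (E al r)) in *.
set (w := var_z (nome al) (nome al * r) (Z al r) (D al) (E al r)) in *.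
assert (HD : is_derive D al ((2 * D al - 2 * v * (1 - Z al r * Z al r)) / al)).
{ unfold D at 1. clearbody v w. auto_derive.
  - repeat split; eexists; eassumption.
  - derive_known. replace (1 - Z al r * Z al r) with (X al r ^ 2 + Y al r ^ 2) by lra. unfold D. field. lra. }
apply (is_derive_ext (fun be => var_z (nome be) (nome be * r) (Z be r) (D be) (E be r) + var_w (nome be) (nome be * r) (Z be r) (D be) (E be r) * E be r - Z be r)); [ easy | ].
revert Hnome HD H3 H4. generalize (4 * nome al * (1 + nome al)). clearbody D. intros n1 Hnome HD H3 H4.
assert (Hv : v = (1 + nome al) * (Z al r * E al r + D al) - nome al * r * Z al r) by reflexivity.
assert (Hw : w = (1 + nome al) * (D al * E al r - Z al r * (1 - Z al r * Z al r)) - (nome al * Z al r + nome al * r * D al)) by reflexivity.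
unfold var_z, var_w. clearbody v w. set (nf := nome) in *. clearbody nf. auto_derive.
- repeat split; try lra; eexists; eassumption.
- derive_known. set (n := nf al) in *. set (zz := Z al r) in *. set (d := D al) in *. set (e := E al r) in *. clearbody n zz d e.
  clear - Ha Hv. subst v. field. lra.
Qed.
End Family.

(** * Bounds at the cusp and conclusion *)

(** [2.008] is the factor [2 + 8 al] of [cusp_bounds] at [al = 1 / 1000]. The claim reduces to
    [e^{31/20} >= 4.016], obtained from the eighth power of [1 + x <= e^x]. *)
Lemma exp_29_20 : 2.008 * exp (9 / 20) <= exp 2 / 2.
Proof.
assert (H : 4.016 <= exp (31 / 20)).
{ replace (31 / 20) with (31 / 160 * 8) by lra.
  assert (H1 := exp_ineq1 (31 / 160) ltac:(lra)).
  assert (H2 : exp (31 / 160 * 8) = exp (31 / 160) ^ 8).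
  { replace (31 / 160 * 8) with (31 / 160 + 31 / 160 + 31 / 160 + 31 / 160 + 31 / 160 + 31 / 160 + 31 / 160 + 31 / 160) by lra.
    rewrite !exp_plus. ring. }
  rewrite H2. apply Rle_trans with ((1 + 31 / 160) ^ 8); [ lra | apply pow_incr; lra ]. }
replace (exp 2) with (exp (31 / 20 + 9 / 20)) by (f_equal; lra). rewrite exp_plus. generalize (exp_pos (9 / 20)). nra.
Qed.

(** Here [1 / y = x / al^2] with [x <= 1], the numerator is at most [4 + 8 al], and
    [geodesic_param_lower] bounds [1 / al^2] through [e^{L/2}], where [L = t + u <= t + 9/10]. *)
Lemma cusp_bounds (al : R) (x y z E : R -> R) (u : R) : geodesic_E al x y z E -> 0 < al <= 1 / 1000 ->
  0 <= u <= 9 / 10 ->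
  let t := Lalpha al - u in
  (E t - z t) / y t / 2 <= (2 + 8 * al) * exp (9 / 20) * exp (t / 2).
Proof.
intros Hg Hal Hu t. assert (Hs := proj1 (proj1 Hg)). assert (HL := Lalpha_gt_4 al Hs).
destruct (geodesic_period _ _ _ _ (proj1 Hg) u) as (Px & Py & Pz).
assert (PE := geodesic_E_period _ _ _ _ _ Hg u). fold t in Px, Py, Pz, PE. rewrite Py, Pz, PE.
assert (H1 := E_gap al x y z E Hg Hal u ltac:(lra)). assert (H2 := E_T al x y z E Hg Hal).
assert (H3 := geodesic_param_lower _ _ _ _ (proj1 Hg)).
destruct (geodesic_x0 _ _ _ _ (proj1 Hg)) as [H4 _].
assert (Hp := geodesic_prod _ _ _ _ (proj1 Hg) u). destruct (geodesic_pos _ _ _ _ (proj1 Hg) u) as [Qx Qy].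
assert (Hx1 : x u <= 1) by (generalize (unit_vector_bounds _ _ _ (geodesic_norm _ _ _ _ (proj1 Hg) u)); lra).
set (w := 4 * E (Lalpha al / 4) - E u - - z u). assert (Hw : 0 <= w <= 4 + 8 * al) by (unfold w; generalize (geodesic_E_ge_z _ _ _ _ _ Hg u); intros; assert (E u <= 2) by (generalize (z_le_id al x y z E Hg u); lra); lra).
assert (He : exp (Lalpha al / 2) <= exp (9 / 20) * exp (t / 2)).
{ rewrite <- exp_plus. replace (Lalpha al / 2) with (u / 2 + t / 2) by (unfold t; field).
  destruct (Req_dec u (9 / 10)) as [->|Hne]; [ right; f_equal; lra | left; apply exp_increasing; lra ]. }
set (X := exp (9 / 20) * exp (t / 2)) in *.
assert (HX : 0 < X) by (unfold X; apply Rmult_lt_0_compat; apply exp_pos).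
assert (Ha2 : 0 < al ^ 2 <= 1 / 1000000) by nra.
assert (K : 1 - al ^ 2 <= al ^ 2 * X) by nra.
replace (w / y u / 2) with (w * x u / (2 * al ^ 2)) by (rewrite <- Hp; field; lra).
apply Rmult_le_reg_r with (2 * al ^ 2); [ lra | ].
replace (w * x u / (2 * al ^ 2) * (2 * al ^ 2)) with (w * x u) by (field; lra).
apply Rle_trans with (4 + 8 * al); [ nra | ].
(* Doubling [2 + 8 al] gives [4 + 16 al]; the surplus [8 al] absorbs the factor [1 - al^2]. *)
apply Rle_trans with ((2 + 8 * al) * 2 * (1 - al ^ 2)); [ nra | ].
replace ((2 + 8 * al) * exp (9 / 20) * exp (t / 2) * (2 * al ^ 2)) with ((2 + 8 * al) * 2 * (al ^ 2 * X)) by (unfold X; ring).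
apply Rmult_le_compat_l; lra.
Qed.

Theorem theorem6p3 (X Y Z A B : R -> R -> R) :
  (forall L : R, L > PI * sqrt 2 -> is_system_solution L (X L) (Y L) (Z L) (A L) (B L)) ->
  forall eps : R, eps > 0 ->
  exists R0 : R, PI * sqrt 2 <= R0 /\
  forall r : R, r > R0 ->
    (* Upsilon_r is differentiable on [r, oo) *)
    (forall L : R, r <= L ->
       ex_derive (Ups1 A r) L /\ ex_derive (Ups2 B r) L) /\
    exists Lr : R, r <= Lr /\
      (* L_r is a cusp *)
      Derive (Ups1 A r) Lr = 0 /\ Derive (Ups2 B r) Lr = 0 /\
      (* at every other L the velocity has negative slope (hence no other cusp) *)
      (forall L : R, r <= L -> L <> Lr ->
         Derive (Ups1 A r) L * Derive (Ups2 B r) L < 0) /\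
      (* the cusp point (a_r, b_r) = Upsilon_r(L_r) *)
      Ups1 A r Lr < 2 + eps /\
      Ups2 B r Lr < (exp 2 / 2 + eps) * exp (r / 2).
Proof.
intros H eps Heps.
destruct end_at_sign as (a0 & Ha0 & Hsign).
set (a1 := Rmin a0 (eps / 10)).
assert (Ha1 : 0 < a1 /\ a1 <= a0 /\ a1 <= eps / 10).
{ split; [ apply Rmin_glb_lt; lra | split; [ apply Rmin_l | apply Rmin_r ] ]. }
(* Since [Lalpha al <= PI / al < 4 / al], every [L >= r > 4 / a1] has a parameter of at most
   [a1]. *)
exists (Rmax (PI * sqrt 2) (4 / a1)). split; [ apply Rmax_l | ]. intros r Hr.
assert (HrP : PI * sqrt 2 < r) by (apply Rle_lt_trans with (2 := Hr), Rmax_l).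
assert (Hr4 : 4 / a1 < r) by (apply Rle_lt_trans with (2 := Hr), Rmax_r).
assert (Hr0 : 0 < r) by (apply Rlt_trans with (2 := Hr4), Rdiv_lt_0_compat; lra).
set (inv := fun L => sqrt (X L 0 * Y L 0)).
assert (Hinv : forall L, PI * sqrt 2 < L -> small_param (inv L) /\ Lalpha (inv L) = L).
{ intros L HL. destruct (H L HL) as (al & x0 & y0 & Ha & HLa & _ & _ & _ & Hp & Hx0 & Hy0 & _).
  assert (E : inv L = al) by (unfold inv; rewrite Hx0, Hy0, Hp, sqrt_pow2; lra). now rewrite E. }
set (X' := fun be => X (Lalpha be)). set (Y' := fun be => Y (Lalpha be)). set (Z' := fun be => Z (Lalpha be)).
set (E' := fun be t => A (Lalpha be) t * X (Lalpha be) t - Z (Lalpha be) t).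
assert (Hsys : forall be, small_param be -> geodesic_E be (X' be) (Y' be) (Z' be) (E' be) /\
  forall t, A (Lalpha be) t = (E' be t + Z' be t) / X' be t /\ B (Lalpha be) t = (E' be t - Z' be t) / Y' be t).
{ intros be Hbe. exact (system_geodesic be _ _ _ _ _ Hbe (H _ (Lalpha_lower be Hbe))). }
assert (HG : forall be, small_param be -> geodesic_E be (X' be) (Y' be) (Z' be) (E' be)) by (intros; now apply Hsys).
set (G := fun be => end_at be (X' be) (Y' be) (Z' be) (E' be) r).
assert (Hpos : forall be t, small_param be -> 0 < be /\ 0 < X' be t /\ 0 < Y' be t).
{ intros be t Hbe. split; [ apply Hbe | exact (geodesic_pos _ _ _ _ (proj1 (HG be Hbe)) t) ]. }
assert (Hder : forall L, r <= L -> exists l, l < 0 /\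
  is_derive (Ups1 A r) L (l * (G (inv L) / (inv L * X' (inv L) r)) / 2) /\
  is_derive (Ups2 B r) L (l * (- G (inv L) / (inv L * Y' (inv L) r)) / 2)).
{ intros L HL. assert (HLP : PI * sqrt 2 < L) by lra. destruct (Hinv L HLP) as [Hs HLa].
  destruct (Lalpha_inverse_derive inv Hinv L HLP) as (l & Hl & Hd). exists l. split; [ easy | ].
  destruct (endpoint_derive X' Y' Z' E' HG r ltac:(lra) (inv L) Hs) as [D1 D2].
  (* The formulas through [inv] hold only for periods above [PI * sqrt 2], an open condition. *)
  assert (Hloc : locally L (fun L' => PI * sqrt 2 < L')) by (apply (locally_interval _ L (PI * sqrt 2) p_infty); simpl; easy).
  split.
  - apply (is_derive_ext_loc (fun L' => / 2 * ((E' (inv L') r + Z' (inv L') r) / X' (inv L') r))).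
    + revert Hloc. apply filter_imp. intros L' HL'. destruct (Hinv L' HL') as [Hs' HLa'].
      unfold Ups1. rewrite <- (proj1 (proj2 (Hsys (inv L') Hs') r)), HLa'. eq_R. field.
    + replace (l * (G (inv L) / (inv L * X' (inv L) r)) / 2) with (/ 2 * (l * (G (inv L) / (inv L * X' (inv L) r)))) by lra.
      apply is_derive_scal. now apply (is_derive_comp (fun be => (E' be r + Z' be r) / X' be r) inv).
  - apply (is_derive_ext_loc (fun L' => / 2 * ((E' (inv L') r - Z' (inv L') r) / Y' (inv L') r))).
    + revert Hloc. apply filter_imp. intros L' HL'. destruct (Hinv L' HL') as [Hs' HLa'].
      unfold Ups2. rewrite <- (proj2 (proj2 (Hsys (inv L') Hs') r)), HLa'. eq_R. field.
    + replace (l * (- G (inv L) / (inv L * Y' (inv L) r)) / 2) with (/ 2 * (l * (- G (inv L) / (inv L * Y' (inv L) r)))) by lra.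
      apply is_derive_scal. now apply (is_derive_comp (fun be => (E' be r - Z' be r) / Y' be r) inv). }
assert (Hsmall : forall L, r <= L -> inv L <= a1).
{ intros L HL. destruct (Hinv L ltac:(lra)) as [Hs HLa]. assert (HU := Lalpha_upper _ Hs). rewrite HLa in HU.
  assert (Ha : 0 < inv L) by apply Hs. assert (HPI := PI_4).
  apply Rmult_le_compat_r with (r := inv L) in HU; [ | lra ]. replace (PI / inv L * inv L) with PI in HU by (field; lra).
  assert (4 < a1 * L).
  { apply Rlt_le_trans with (a1 * r); [ | nra ]. apply Rmult_lt_compat_l with (r := a1) in Hr4; [ | lra ].
    replace (a1 * (4 / a1)) with 4 in Hr4 by (field; lra). easy. }
  apply Rnot_lt_le. intros Hc. nra. }
split.
{ intros L HL. destruct (Hder L HL) as (l & _ & D1 & D2). split; eexists; eassumption. }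
destruct (Hinv r HrP) as [Hsr HLr]. set (ar := inv r) in *.
(* The parameter decreases with the period, so [[as_, ar]] corresponds to the periods in
   [[r, r + 9/10]]; [G] increases there from a negative to a positive value. *)
destruct (Hinv (r + 9 / 10) ltac:(lra)) as [Hss HLs]. set (as_ := inv (r + 9 / 10)) in *.
assert (Hord : as_ < ar).
{ apply Rnot_le_lt. intros [Hc|Hc]; [ generalize (Lalpha_decr ar as_ (proj1 Hsr) Hc); lra | rewrite Hc in HLr; lra ]. }
assert (Hmid : forall be, as_ <= be <= ar -> small_param be).
{ intros be Hbe. destruct Hss, Hsr. split; lra. }
assert (HLmid : forall be, as_ <= be <= ar -> r <= Lalpha be <= r + 9 / 10).
{ intros be Hbe. split.
  - destruct (Req_dec be ar) as [->|Hne]; [ lra | ]. generalize (Lalpha_decr be ar (proj1 (Hmid be Hbe)) ltac:(lra)). lra.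
  - destruct (Req_dec be as_) as [->|Hne]; [ lra | ]. generalize (Lalpha_decr as_ be (proj1 Hss) ltac:(lra)). lra. }
assert (Hinvl : forall be, as_ <= be <= ar -> inv (Lalpha be) = be).
{ intros be Hbe. assert (HLb := HLmid be Hbe). destruct (Hinv (Lalpha be) ltac:(lra)) as [S1 S2].
  apply Lalpha_inj; [ apply S1 | apply (Hmid be Hbe) | easy ]. }
assert (Hara1 : ar <= a1) by (apply Hsmall; lra).
assert (HGd : forall be, as_ <= be <= ar -> is_derive G be (end_deriv_at be (X' be) (Y' be) (Z' be) (E' be) r / be)).
{ intros be Hbe. exact (end_at_derive X' Y' Z' E' HG r ltac:(lra) be (Hmid be Hbe)). }
assert (HGp : forall be, as_ <= be <= ar -> 0 < end_deriv_at be (X' be) (Y' be) (Z' be) (E' be) r / be).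
{ intros be Hbe. destruct (Hsign be _ _ _ _ (HG be (Hmid be Hbe)) ltac:(lra)) as (_ & S2 & _).
  assert (HLb := HLmid be Hbe). specialize (S2 (Lalpha be - r) ltac:(lra)).
  replace (Lalpha be - (Lalpha be - r)) with r in S2 by ring.
  apply Rdiv_lt_0_compat; [ easy | apply (Hmid be Hbe) ]. }
assert (HGmono : forall b1 b2, as_ <= b1 -> b1 < b2 -> b2 <= ar -> G b1 < G b2).
{ intros b1 b2 H1 H2 H3. apply (deriv_gt0_incr G (fun be => end_deriv_at be (X' be) (Y' be) (Z' be) (E' be) r / be)); [ easy | | ].
  - intros t Ht. apply HGd. lra.
  - intros t Ht. apply HGp. lra. }
assert (HGs : G as_ < 0).
{ apply (Hsign as_ _ _ _ _ (HG as_ Hss) ltac:(lra)). lra. }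
assert (HGr : 0 < G ar).
{ destruct (Hsign ar _ _ _ _ (HG ar Hsr) ltac:(lra)) as (_ & _ & S3). rewrite HLr in S3. exact S3. }
destruct (Ranalysis5.IVT_interv G as_ ar) as (a_c & Hac & HGc); try easy.
{ intros be Hbe. apply ex_derive_continuity_pt. eexists. now apply HGd. }
assert (HLc := HLmid a_c Hac). assert (Hic := Hinvl a_c Hac).
exists (Lalpha a_c). split; [ lra | ].
destruct (Hder (Lalpha a_c) ltac:(lra)) as (lc & Hlc & D1c & D2c). rewrite Hic, HGc in D1c, D2c.
split. { rewrite (is_derive_unique _ _ _ D1c). unfold Rdiv. ring. }
split. { rewrite (is_derive_unique _ _ _ D2c). unfold Rdiv. ring. }
split.
{ intros L HL Hne. destruct (Hder L HL) as (l & Hl & D1 & D2).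
  rewrite (is_derive_unique _ _ _ D1), (is_derive_unique _ _ _ D2).
  destruct (Hinv L ltac:(lra)) as [Hs HLL]. destruct (Hpos (inv L) r Hs) as (P1 & P2 & P3).
  assert (HGL : G (inv L) <> 0).
  (* Beyond [r + 9/10] the time [r] lies in the range where [end_at] is negative; before it, strict
     monotonicity of [G] excludes a second zero. *)
  { destruct (Rle_dec (r + 9 / 10) L) as [Hc|Hc].
    - apply Rlt_not_eq. assert (Ha := Hsmall L HL). apply (Hsign (inv L) _ _ _ _ (HG _ Hs) ltac:(lra)). lra.
    - assert (Hin : as_ <= inv L <= ar).
      { split; apply Rnot_lt_le; intros Hlt.
        - generalize (Lalpha_decr _ _ P1 Hlt). lra.
        - generalize (Lalpha_decr _ _ (proj1 Hsr) Hlt). lra. }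
      assert (Hna : inv L <> a_c) by (intros Heq; apply Hne; now rewrite <- Heq).
      destruct (Rtotal_order (inv L) a_c) as [Hlt|[Heq|Hgt]]; [ | easy | ].
      + generalize (HGmono _ _ (proj1 Hin) Hlt (proj2 Hac)). lra.
      + generalize (HGmono _ _ (proj1 Hac) Hgt (proj2 Hin)). lra. }
  set (g := G (inv L)) in *. set (c := inv L) in *. set (xx := X' c r) in *. set (yy := Y' c r) in *.
  replace (l * (g / (c * xx)) / 2 * (l * (- g / (c * yy)) / 2)) with (- ((l * g) ^ 2 / (4 * c ^ 2 * xx * yy))) by (field; lra).
  apply Ropp_lt_gt_0_contravar. apply Rdiv_lt_0_compat.
  - assert (l * g <> 0) by (apply Rmult_integral_contrapositive; split; lra). assert (0 < (l * g) ^ 2) by (apply pow2_gt_0; easy). easy.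
  - repeat apply Rmult_lt_0_compat; lra. }
split.
- unfold Ups1. rewrite (proj1 (proj2 (Hsys a_c (Hmid a_c Hac)) r)).
  set (fa := fun be => (E' be r + Z' be r) / X' be r).
  (* [G >= 0] between [a_c] and [ar], so the first coordinate is largest at [ar], where [r] is a
     full period and the value is explicit: [4 E(r/4) / x(0)]. *)
  assert (Hmono : fa a_c <= fa ar).
  { apply (deriv_ge0_incr fa (fun be => G be / (be * X' be r))); [ lra | | ].
    - intros be Hbe. now apply (endpoint_derive X' Y' Z' E' HG r ltac:(lra) be (Hmid be ltac:(lra))).
    - intros be Hbe. destruct (Hpos be r (Hmid be ltac:(lra))) as (P1 & P2 & _).
      assert (0 <= G be). { rewrite <- HGc. destruct (Req_dec be a_c) as [->|Hne]; [ lra | left; apply HGmono; lra ]. }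
      apply Rdiv_le_0_compat; [ easy | now apply Rmult_lt_0_compat ]. }
  assert (Hgr := HG ar Hsr). assert (H0ar : 0 < ar) by apply Hsr.
  destruct (geodesic_period _ _ _ _ (proj1 Hgr) 0) as (Px & _ & Pz).
  assert (PE := geodesic_E_period _ _ _ _ _ Hgr 0). rewrite Rminus_0_r, HLr in Px, Pz, PE.
  assert (HZ0 : Z' ar 0 = 0) by apply Hgr. assert (HE0 : E' ar 0 = 0) by apply Hgr.
  assert (HET := E_T ar _ _ _ _ Hgr ltac:(lra)). rewrite HLr in HET.
  destruct (geodesic_x0 _ _ _ _ (proj1 Hgr)) as [_ [Hx0 _]].
  unfold fa in Hmono at 2. rewrite Px, Pz, PE, HZ0, HE0 in Hmono.
  assert (Hb : (4 * E' ar (r / 4) - 0 + - 0) / X' ar 0 <= 4 + 16 * ar).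
  { apply Rmult_le_reg_r with (X' ar 0); [ nra | ]. field_simplify; [ nra | nra ]. }
  change (fa a_c / 2 < 2 + eps). lra.
- unfold Ups2. rewrite (proj2 (proj2 (Hsys a_c (Hmid a_c Hac)) r)).
  assert (Hgc := HG a_c (Hmid a_c Hac)).
  assert (HB := cusp_bounds a_c _ _ _ _ (Lalpha a_c - r) Hgc ltac:(split; [ apply (Hmid a_c Hac) | lra ]) ltac:(lra)).
  cbv zeta in HB. replace (Lalpha a_c - (Lalpha a_c - r)) with r in HB by ring.
  apply Rle_lt_trans with (1 := HB). apply Rmult_lt_compat_r; [ apply exp_pos | ].
  assert (HX := exp_29_20). generalize (exp_pos (9 / 20)). intros.
  apply Rle_lt_trans with (exp 2 / 2); [ | lra ]. apply Rle_trans with (2 := HX). apply Rmult_le_compat_r; lra.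
Qed.
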